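(* Let $n\ge 7$ and let $G$ be an $n$-vertex, $2$-connected plane graph that does not contain $C_7$ as a subgraph and that has no $(18/7)$-sparse set of order at most $4$. Then $e(G)\le \frac{18}{7}n-\frac{48}{7}$.
   Context: For a graph $G$ and a constant $\alpha>0$, a set $S\subseteq V(G)$ is $\alpha$-sparse if $G$ has at most $\alpha|S|$ edges with at least one end in $S$. $e(G)$ is the number of edges of $G$; $C_7$ is the cycle of length $7$. A plane graph is a planar graph together with a fixed embedding in the plane. *)

(* Defs.v *)
From HB Require Import structures.
From mathcomp Require Import all_boot all_order all_fingroup all_algebra.
Set Implicit Arguments. Unset Strict Implicit. Unset Printing Implicit Defensive.
Import Order.TTheory GRing.Theory Num.Theory.

(* A finite simple graph: vertex type T (a finType), adjacency e : rel T,
   assumed symmetric and irreflexive (hypotheses of the theorem). *)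

Section Graphs.
Variables (T : finType) (e : rel T).

Definition edges : {set {set T}} :=
  [set p : {set T} | [exists x, exists y, e x y && (p == [set x; y])]].

Definition nedges : nat := #|edges|.

Definition edges_touching (S : {set T}) : {set {set T}} :=
  [set p in edges | [exists x in S, x \in p]].

Definition sparse (alpha : rat) (S : {set T}) : bool :=
  ((#|edges_touching S|)%:R <= alpha * (#|S|)%:R)%R.

Definition connected_avoiding (X : {set T}) : Prop :=
  forall x y, x \notin X -> y \notin X ->
    connect [rel u v | e u v && (u \notin X) && (v \notin X)] x y.

Definition connected_graph : Prop := connected_avoiding set0.

Definition two_connected : Prop :=
  2 < #|T| /\ connected_graph /\ forall v : T, connected_avoiding [set v].

Definition has_C7 : Prop :=
  exists f : 'I_7 -> T, injective f /\
    forall i : 'I_7, e (f i) (f (inord ((i.+1) %% 7))).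

Definition darts : {set T * T} := [set d | e d.1 d.2].

Definition rotation_system (rot : {perm (T * T)}) : Prop :=
  [/\ forall d, d \in darts -> (rot d \in darts) /\ (rot d).1 = d.1,
      forall d, d \notin darts -> rot d = d &
      forall d d', d \in darts -> d' \in darts -> d.1 = d'.1 -> fconnect rot d d'].

Definition face_perm (rot : {perm (T * T)}) (d : T * T) : T * T :=
  if d \in darts then rot (d.2, d.1) else d.

Definition nfaces (rot : {perm (T * T)}) : nat := fcard (face_perm rot) darts.

(* A plane embedding of the (connected) graph: a rotation system (combinatorial
   map) of genus 0, i.e. satisfying Euler's formula V - E + F = 2, written as
   2V + 2F = #darts + 4 (the number of darts is 2E). *)
Definition plane_embedding (rot : {perm (T * T)}) : Prop :=
  rotation_system rot /\ (2 * #|T| + 2 * nfaces rot = #|darts| + 4)%N.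

Definition plane_graph : Prop := exists rot, plane_embedding rot.

End Graphs.

(* Main.v *)
(** By Euler's formula the bound is equivalent to 24 f - 17 m + 6 n <= 0 for the
    numbers n, m, f of vertices, edges and faces.  This quantity is distributed
    over the darts: a dart on a face of length l receives 24/l - 17/2, and each
    vertex hands out 6, shared equally by its non-triangular corners, or by all
    its darts if all its corners are triangular.  Darts are grouped into blocks,
    the classes generated by reversal and by steps around triangular faces.
    Two corrections then make every block nonpositive.  An edge between a 4-face
    and a face of length at least 6 takes over some charge of the opposite edge of
    the 4-face if an end of the latter has a single non-triangular corner.  A face
    of length l >= 8 takes over some charge of its "special" vertices, those with
    one non-triangular corner whose neighbours on the face are joined by a chord;
    there are at most l - 8 of them, as bypassing l - 7 of them leaves a C_7.

    That a block is nonpositive is a finite matter: the plane map around a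
    dart is explored exhaustively, branching on face lengths and on the next
    vertex of a face.  Branches die by a C_7, a sparse set of at most four vertices,
    a face visiting a vertex twice, a 1-vertex cut, or two adjacent vertices seeing
    their common neighbours in inconsistent orders.  The topological facts needed
    follow from a form of the Jordan curve theorem: by Euler's formula and a
    comparison of ranks over F_2, every closed walk is a sum of face boundaries. *)

Require Import Defs.
From mathcomp Require Import all_boot all_order all_fingroup all_algebra zify lra.
Set Implicit Arguments. Unset Strict Implicit. Unset Printing Implicit Defensive.
Import Order.TTheory GRing.Theory Num.Theory.

(** * Exploration of partial plane maps *)

Fixpoint memn (x : nat) (s : seq nat) : bool :=
  if s is y :: s' then (if eqn x y then true else memn x s') else false.
Fixpoint uniqn (s : seq nat) : bool :=
  if s is y :: s' then (if memn y s' then false else uniqn s') else true.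
Fixpoint memd (d : nat * nat) (s : seq (nat * nat)) : bool :=
  if s is d' :: s' then
    (if eqn d.1 d'.1 then (if eqn d.2 d'.2 then true else memd d s') else memd d s')
  else false.
Fixpoint uniqd (s : seq (nat * nat)) : bool :=
  if s is y :: s' then (if memd y s' then false else uniqd s') else true.
Definition isnil (X : Type) (s : seq X) := if s is [::] then true else false.
Definition find_some (X : Type) (p : X -> bool) : seq X -> option X :=
  fix go l := if l is x :: l' then (if p x then Some x else go l') else None.

(* A partial plane map on pairwise distinct vertices 0, ..., K - 1: adjacency lists
   A; the next vertex on a face, F s u v = w.+1 if the face of the dart uv goes on
   to w, and its inverse, G s v w = u.+1 (0 means unknown); face types, with 0
   unknown, 1 length at least 4, 8 length at least 8, and 3, 4, 5, 6 that very length
   (length 7 would be a C_7); and, for vertices whose rotation is completely known,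
   the cyclic list C of all neighbours (empty if unknown). *)
Record state := State {
  K : nat;
  A : seq (seq nat);
  Ft : seq (seq nat);
  Gt : seq (seq nat);
  Tt : seq (seq nat);
  Ct : seq (seq nat) }.

Definition get (t : seq (seq nat)) u v := nth 0 (nth [::] t u) v.
Definition set (t : seq (seq nat)) u v x := set_nth [::] t u (set_nth 0 (nth [::] t u) v x).
Definition adj s u := nth [::] (A s) u.
Definition F s u v := get (Ft s) u v.
Definition G s v w := get (Gt s) v w.
Definition ty s u v := get (Tt s) u v.
Definition cl s v := nth [::] (Ct s) v.

(* Can the path that visited [vis] and stands at [cur] take n more vertices and
   then an edge to [goal]? *)
Fixpoint ext (a : seq (seq nat)) (n : nat) (vis : seq nat) (cur goal : nat) : bool :=
  if n is n'.+1 then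
    has (fun z => if memn z vis then false else ext a n' (z :: vis) z goal) (nth [::] a cur)
  else memn goal (nth [::] a cur).

(** A C_7 created here must use the edge uv, so only paths from v back to u through five further
    vertices have to be tested. A vertex whose rotation is completely known admits no new
    neighbour. *)
Definition add_edge s u v : option state :=
  if eqn u v then None else
  if memn v (adj s u) then Some s else
  if (isnil (cl s u) || memn v (cl s u)) && (isnil (cl s v) || memn u (cl s v)) then
    let a := set_nth [::] (A s) u (v :: adj s u) in
    let a := set_nth [::] a v (u :: nth [::] a v) in
    if ext a 5 [:: v; u] v u then None
    else Some (State (K s) a (Ft s) (Gt s) (Tt s) (Ct s))
  else None.

Fixpoint back s n u v a b : nat * nat :=
  if n is n'.+1 then
    if G s a b is c.+1 then
      if eqn c u && eqn a v then (u, v) else back s n' u v c a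
    else (a, b)
  else (a, b).
Fixpoint fwd s n a b x y : seq (nat * nat) * bool :=
  if n is n'.+1 then
    if F s x y is w.+1 then
      if eqn y a && eqn w b then ([:: (x, y)], true)
      else let: (l, c) := fwd s n' a b y w in ((x, y) :: l, c)
    else ([:: (x, y)], false)
  else ([:: (x, y)], false).
(* The known part of the face of the dart uv, and whether it closes up.  The fuel 14
   exceeds the length of all segments that occur; running out of it is harmless. *)
Definition seg s u v := let: (a, b) := back s 14 u v u v in fwd s 14 a b a b.

Definition tjoin a b : option nat :=
  match a, b with
  | 0, _ => Some b
  | _, 0 => Some a
  | 1, 3 => None | 3, 1 => None
  | 1, _ => Some b
  | _, 1 => Some a
  | _, _ => if eqn a b then Some a else None
  end.

Definition set_types s (l : seq (nat * nat)) t :=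
  State (K s) (A s) (Ft s) (Gt s) (foldr (fun d tt => set tt d.1 d.2 t) (Tt s) l) (Ct s).

(** Faces visit no vertex twice, so a segment returning to its first tail is a whole face, and any
    other repetition is a contradiction. An open segment of m darts lies on a face of length greater
    than m. *)
Definition face_ok (l : seq (nat * nat)) (c : bool) (t : nat) : bool :=
  let tails := map fst l in
  let m := size l in
  let h := last 0 (map snd l) in
  if uniqn tails then
    if c || eqn h (head 0 tails) then
      match t with 0 => true | 1 => 4 <= m | 8 => 8 <= m | _ => eqn m t end
    else if memn h tails then false
    else match t with 0 => true | 1 => true | 8 => true | _ => m < t end
  else false.

Definition set_type s u v t : option state :=
  if tjoin (ty s u v) t is Some t' then
    let: (l, c) := seg s u v in
    if face_ok l c t' then Some (set_types s l t') else None
  else None.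

(** The neighbour of v following x in the rotation is the vertex after v on the face of xv. The
    empty list signals that some step on the way to u is unknown. *)
Fixpoint rotation s n v x u : seq nat :=
  if n is n'.+1 then
    if eqn x u then [:: u] else
    if F s x v is y.+1 then
      let l := rotation s n' v y u in if isnil l then [::] else x :: l
    else [::]
  else [::].

(** An edge inside S is counted only at the end that comes later in S. This requires all members of
    S to have known rotations. *)
Fixpoint touch s (S : seq nat) : nat :=
  if S is v :: S' then count (fun w => ~~ memn w S') (cl s v) + touch s S' else 0.

(** S is enlarged by members of l in every possible way. For the present and the next sizes k,
    [need] lists the least integer above 18k/7, that is 3, 6, 8, 11 for k = 1, ..., 4. *)
Fixpoint some_sparse s (need : seq nat) (S : seq nat) (l : seq nat) : bool :=
  if need is b :: need' then
    if touch s S < b then true else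
    (fix go l := if l is x :: l' then
       (if some_sparse s need' (x :: S) l' then true else go l') else false) l
  else false.

Definition from x (l : seq nat) := behead (rot (index x l) l).
(** All rotations turn in the same sense, so in a plane map the common neighbours of u and v, listed
    from the edge uv, occur in opposite orders at its two ends. Two of them in the same order are a
    contradiction. *)
Definition crossing s u v :=
  let a := from v (cl s u) in let b := from u (cl s v) in
  let c := filter (fun x => memn x b) a in
  has (fun x => has (fun y => (index x a < index y a) && (index x b < index y b)) c) c.

Definition closed s v := ~~ isnil (cl s v).

(** The second test concerns at most six named vertices, at most one of them open: all others being
    closed, the open one would be a cut vertex, or the graph would be too small. *)
Definition bad_closed s v : bool :=
  let c := filter (closed s) (iota 0 (K s)) in
  let c' := filter (fun w => ~~ eqn w v) c in
  [|| some_sparse s [:: 3; 6; 8; 11] [:: v] c',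
      (K s <= 6) && (K s <= (size c).+1)
   | has (fun u => if memn u (cl s v) && memn v (cl s u) then crossing s u v else false) c'].

Definition close s v r : option state :=
  if isnil r || ~~ uniqn r then Some s else
  if size r < size (adj s v) then None else
  let s' := State (K s) (A s) (Ft s) (Gt s) (Tt s) (set_nth [::] (Ct s) v r) in
  if bad_closed s' v then None else Some s'.

Definition add_next s u v w : option state :=
  if F s u v is f.+1 then (if eqn f w then Some s else None) else
  (* A face turning back at v would make u the only neighbour of v, but degrees are at least 3. *)
  if eqn u w then None else
  if G s v w is u'.+1 then (if eqn u' u then Some s else None) else
  let t1 := ty s u v in let t2 := ty s v w in
  let s := State (K s) (A s) (set (Ft s) u v w.+1) (set (Gt s) v w u.+1) (Tt s) (Ct s) in
  if tjoin t1 t2 is Some t then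
    let: (l, c) := seg s u v in
    if face_ok l c t then
      if add_edge s v w is Some s then
        let s := if eqn t1 t && eqn t2 t then s else set_types s l t in
        close s v (rotation s 14 v w u)
      else None
    else None
  else None.

Definition outer_type t := match t with 0 => false | 3 => false | _ => true end.
(* A lower bound for the number of non-triangular corners at v; [single] certifies
   that there is at most one. *)
Definition rlow s v :=
  maxn (count (fun u => outer_type (ty s u v)) (adj s v))
       (count (fun u => outer_type (ty s v u)) (adj s v)).
Definition single s v :=
  closed s v && eqn (count (fun u => eqn (ty s u v) 3) (cl s v)).+1 (size (cl s v)).

Definition opposite s u v : option (nat * nat) :=
  if F s u v is w.+1 then (if F s v w is x.+1 then Some (w, x) else None) else None.

Definition give_upper s u v :=
  match ty s u v with
  | 0 | 1 => match ty s v u with 0 | 1 | 6 | 8 => 25 | _ => 0 end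
  | 4 =>
    let a := match ty s v u with 0 | 1 | 8 => 25 | 6 => 20 | _ => 0 end in
    if opposite s u v is Some (x, y) then
      (if (2 <= rlow s x) && (2 <= rlow s y) then 0 else a) else a
  | _ => 0 end.
Definition give_lower s u v :=
  if eqn (ty s u v) 4 then
    let a := match ty s v u with 8 => 25 | 6 => 20 | _ => 0 end in
    if opposite s u v is Some (x, y) then (if single s x || single s y then a else 0) else 0
  else 0.
Definition special_in s u v :=
  [&& eqn (ty s u v) 8, single s v &
   if F s u v is y.+1 then [&& memn y (adj s u), 2 <= rlow s u & 2 <= rlow s y] else false].

(* [wpos - wneg] bounds the corrected charge of a dart, scaled by 10, from above. *)
Definition wpos s (d : nat * nat) : nat :=
  let: (u, v) := d in
  match ty s u v with
  | 3 => if 1 <= rlow s v then 0 else match size (cl s v) with 4 => 15 | 5 => 12 | _ => 20 end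
  | _ => (match rlow s v with 0 | 1 => 60 | 2 => 30 | _ => 20 end) + give_upper s u v
  end.
Definition wneg s (d : nat * nat) : nat :=
  let: (u, v) := d in
  match ty s u v with
  | 3 => 5
  | 4 => 25 + (if opposite s u v is Some (x, y) then give_lower s x y else 0)
  | 5 => 37 | 6 => 45
  | 8 => if special_in s u v then 85 else 55
  | _ => 25
  end.

Fixpoint block s n (todo acc : seq (nat * nat)) : seq (nat * nat) :=
  if n is n'.+1 then
    if todo is d :: todo then
      if memd d acc then block s n' todo acc else
      let todo := (d.2, d.1) :: todo in
      let todo := if eqn (ty s d.1 d.2) 3 then
        (if F s d.1 d.2 is w.+1 then (d.2, w) :: todo else todo) else todo in
      block s n' todo (d :: acc)
    else acc
  else acc.

(** [block] collects only darts of the class of ab. Closure under the generating steps shows that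
    none is missing, so the fuel of [block] needs no analysis. *)
Definition full_block s a b (bl : seq (nat * nat)) : bool :=
  memd (a, b) bl && uniqd bl && all (fun d => let: (u, v) := d in
    [&& memd (v, u) bl, ~~ eqn (ty s u v) 0 &
     if eqn (ty s u v) 3 then (if F s u v is w.+1 then memd (v, w) bl else false) else true]) bl.

Definition sumf (f : nat * nat -> nat) (l : seq (nat * nat)) := foldr (fun d a => f d + a) 0 l.
Definition good s bl := sumf (wpos s) bl <= sumf (wneg s) bl.

(* What to branch on next is a heuristic: soundness only depends on each branching
   being exhaustive, which [step] ensures by itself. *)
Inductive action := Next of nat & nat | Kind of nat & nat | Done | Stuck.
Definition untyped s (d : nat * nat) := eqn (ty s d.1 d.2) 0.

Definition explore s v : action :=
  let es := filter (fun d => eqn (F s d.1 d.2) 0) (map (fun u => (u, v)) (adj s v)) in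
  if find_some (untyped s) es is Some d then Kind d.1 d.2 else
  if find_some (fun d => eqn (ty s d.1 d.2) 1) es is Some d then Kind d.1 d.2 else
  if es is d :: _ then Next d.1 d.2 else Stuck.

Definition pick s (bl : seq (nat * nat)) : action :=
  let need c := fun v => if closed s v then false else rlow s v < c in
  let vs := map fst bl in
  if find_some (need 2) vs is Some v then explore s v else
  let donor d := let: (u, v) := d in
    if eqn (ty s u v) 4 && (single s u || single s v) then
      if opposite s u v is Some (x, y) then ty s y x < 2 else false else false in
  if find_some donor bl is Some (u, v) then
    if opposite s u v is Some (x, y) then Kind y x else Stuck else
  let ends d := let: (u, v) := d in
    if eqn (ty s u v) 4 && (0 < give_upper s u v) then
      if opposite s u v is Some (x, y) then [:: x; y] else [::] else [::] in
  if find_some (need 2) (flatten (map ends bl)) is Some v then explore s v else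
  if find_some (need 3) vs is Some v then explore s v else Stuck.

Definition unfinished6 s bl : option (nat * nat) :=
  find_some (fun d => eqn (ty s d.1 d.2) 6 && eqn (F s d.1 d.2) 0)
    (flatten (map (fun d => if eqn (ty s d.1 d.2) 6 then fst (seg s d.1 d.2) else [::]) bl)).

Definition choose s bl : action :=
  if find_some (untyped s) bl is Some d then Kind d.1 d.2 else
  if good s bl then Done else
  if unfinished6 s bl is Some d then Next d.1 d.2 else
  if find_some (fun d => eqn (ty s d.1 d.2) 1) bl is Some d then Kind d.1 d.2 else
  pick s bl.

(** The dart returned is branched on at once. Thus a face whose length is fixed as 3, 4 or 5 is
    traced to its end immediately, and a hexagon as soon as one of its steps is branched on. *)
Definition next_on_face s x y w : option (nat * nat) :=
  match ty s x y with
  | 3 | 4 | 5 | 6 => if F s y w is 0 then Some (y, w) else None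
  | _ => None end.
Definition last_on_face s x y t : option (nat * nat) :=
  match t with
  | 3 | 4 | 5 => let: (l, c) := seg s x y in if c then None else Some (last (0, 0) l)
  | _ => None end.

(* The reverse ba of the root has a longest non-triangular face of the block, and it
   is triangular only if all faces are: this prunes the types of block darts. *)
Definition short_kinds t : seq nat :=
  match t with 4 => [:: 4] | 5 => [:: 4; 5] | 6 => [:: 4; 5; 6] | _ => [:: 4; 5; 6; 8] end.
Definition kinds s a b bl x y : seq nat :=
  match ty s x y with
  | 0 => if eqn (ty s b a) 3 then [:: 3] else [:: 3; 1]
  | 1 => short_kinds (if memd (x, y) bl then ty s b a else 8)
  | t => [:: t]
  end.

Definition widen s := State (K s).+1 (A s) (Ft s) (Gt s) (Tt s) (Ct s).

Definition branch (rec : state -> option (nat * nat) -> bool) s x y w : bool :=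
  if add_next s x y w is Some s' then rec s' (next_on_face s' x y w) else true.
(** The vertex after y is a named one or a new one, which receives the first free name [K s]; so the
    cases are exhaustive. *)
Definition try_next rec s x y : bool :=
  if memn y (adj s x) then
    if all (branch rec s x y) (iota 0 (K s)) then branch rec (widen s) x y (K s) else false
  else false.
Definition try_kinds (rec : state -> option (nat * nat) -> bool) a b s bl x y : bool :=
  if memn y (adj s x) then
    all (fun t => if set_type s x y t is Some s' then
      rec s' (last_on_face s' x y t) else true) (kinds s a b bl x y)
  else false.
Definition step rec a b s (pending : option (nat * nat)) : bool :=
  if pending is Some d then try_next rec s d.1 d.2 else
  let bl := block s 200 [:: (a, b)] [::] in
  match choose s bl with
  | Done => if full_block s a b bl then good s bl else false
  | Next x y => try_next rec s x y
  | Kind x y => try_kinds rec a b s bl x y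
  | Stuck => false
  end.
Fixpoint search (fuel : nat) (a b : nat) s pending : bool :=
  if fuel is n.+1 then step (search n a b) a b s pending else false.

Definition edge_state := State 2 [:: [:: 1]; [:: 0]] [::] [::] [::] [::].
(** The root ab of a block has one of three surroundings: no triangle on either side; a triangle on
    its own side only; or all faces of the graph are triangles. *)
Definition run_trivial f :=
  if set_type edge_state 0 1 1 is Some s then
    if set_type s 1 0 1 is Some s then search f 0 1 s None else true
  else true.
Definition run_triangle f :=
  if set_type edge_state 0 1 3 is Some s then
    if set_type s 1 0 1 is Some s then search f 0 1 s (Some (0, 1)) else true
  else true.
Definition run_triangulation f :=
  if set_type edge_state 1 0 3 is Some s then search f 0 1 s (Some (1, 0)) else true.

(** * Plane maps *)

Section Plane.

Variables (T : finType) (e : rel T) (rt : {perm (T * T)}).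
Hypotheses (e_sym : symmetric e) (e_irr : irreflexive e).
Hypothesis rtP : rotation_system e rt.

Local Notation D := (darts e).
Local Notation fp := (face_perm e rt).

Definition swap (d : T * T) : T * T := (d.2, d.1).

Lemma swapK : involutive swap. Proof. by case. Qed.

Lemma dartE u v : ((u, v) \in D) = e u v. Proof. by rewrite inE. Qed.

Lemma dart_swap d : (swap d \in D) = (d \in D).
Proof. by rewrite !inE e_sym. Qed.

Lemma rt_dart d : (rt d \in D) = (d \in D).
Proof.
case: rtP => h1 h2 _; case Dd: (d \in D); first by case: (h1 d Dd).
by rewrite h2 ?Dd.
Qed.

Lemma rt_tail d : (rt d).1 = d.1.
Proof.
case: rtP => h1 h2 _; case Dd: (d \in D); first by case: (h1 d Dd).
by rewrite h2 ?Dd.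
Qed.

Lemma fp_dart d : (fp d \in D) = (d \in D).
Proof.
rewrite /face_perm; case Dd: (d \in D); rewrite ?Dd //.
by rewrite rt_dart (dart_swap d).
Qed.

Lemma fpE d : d \in D -> fp d = rt (swap d).
Proof. by rewrite /face_perm => ->. Qed.

Lemma fp_tail d : d \in D -> (fp d).1 = d.2.
Proof. by move=> Dd; rewrite fpE // rt_tail. Qed.

Lemma fp_inj : injective fp.
Proof.
move=> d1 d2 eq12; have: (fp d1 \in D) = (fp d2 \in D) by rewrite eq12.
rewrite !fp_dart; case D1: (d1 \in D) => D2.
  by move: eq12; rewrite !fpE -?D2 // => /perm_inj /(can_inj swapK).
by move: eq12; rewrite /face_perm D1 -D2.
Qed.

(** For an edge uv this is both the vertex after v on the face of uv and the successor of u in the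
    rotation at v. *)
Definition nx u v := (fp (u, v)).2.

Lemma fp_nx u v : e u v -> fp (u, v) = (v, nx u v).
Proof. by move=> uv; rewrite [LHS]surjective_pairing fp_tail // dartE. Qed.

Lemma nx_edge u v : e u v -> e v (nx u v).
Proof. by move=> uv; rewrite -dartE -fp_nx // fp_dart dartE. Qed.

Lemma rt_nx u v : e u v -> rt (v, u) = (v, nx u v).
Proof. by move=> uv; rewrite -fp_nx // fpE ?dartE. Qed.

Lemma nx_inj u u' v : e u v -> e u' v -> nx u v = nx u' v -> u = u'.
Proof.
move=> uv u'v eqn; have: fp (u, v) = fp (u', v) by rewrite !fp_nx // eqn.
by move/fp_inj => [].
Qed.

(** The rotation at v is a single cycle on the darts leaving v; induction follows it from x. *)
Lemma rotation_closed v x (S : {pred T}) :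
  e v x -> x \in S -> (forall y, e y v -> y \in S -> nx y v \in S) ->
  forall z, e v z -> z \in S.
Proof.
move=> vx xS clS z vz; case: rtP => _ _ /(_ (v, x) (v, z)).
rewrite !dartE => /(_ vx vz erefl) /iter_findex.
move: (findex _ _ _) => n; elim: n z vz => [|n IHn] z vz /=; first by case=> <-.
have vE m : (iter m rt (v, x)).1 = v by elim: m => //= m; rewrite rt_tail.
case E: (iter n rt (v, x)) (vE n) => [v' y] /= v'E; rewrite {}v'E in E * => rz.
have vy : e v y by rewrite -dartE -rt_dart rz dartE.
have yS := IHn y vy E; rewrite rt_nx in rz; last by rewrite e_sym.
by case: rz => <-; apply: clS; rewrite // e_sym.
Qed.

Hypothesis euler : (2 * #|T| + 2 * nfaces e rt = #|darts e| + 4)%N.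
Hypothesis conn2 : two_connected e.

Lemma conn1 : connected_graph e.
Proof. by case: conn2 => _ []. Qed.

Lemma T_gt1 : 1 < #|T|.
Proof. by case: conn2 => /ltnW. Qed.

Lemma connected_path x y : exists2 p, path e x p & y = last x p.
Proof.
have := @conn1 x y; rewrite !inE => /(_ isT isT) /connectP [p pp ->].
by exists p => //; apply: sub_path pp => a b /=; case/andP => /andP [].
Qed.

(** [swap] and the face permutation generate the rotation, and by connectedness the three act
    transitively on the darts. *)
Lemma dart_ind (P : T * T -> Prop) d0 :
  d0 \in D -> P d0 ->
  (forall d, d \in D -> P d -> P (swap d)) ->
  (forall d, d \in D -> P d -> P (fp d)) ->
  forall d, d \in D -> P d.
Proof.
move=> Dd0 P0 Psw Pfp.
have Prt d : d \in D -> P d -> P (rt d).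
  by move=> Dd Pd; rewrite -(swapK d) -fpE ?dart_swap //; apply/Pfp/Psw; rewrite ?dart_swap.
have Ptail d d' : d \in D -> d' \in D -> d.1 = d'.1 -> P d -> P d'.
  move=> Dd Dd' eqd Pd; case: rtP => _ _ /(_ d d' Dd Dd' eqd) /iter_findex <-.
  move: (findex _ _ _) => n; elim: n => //= n IHn; apply: Prt => //.
  by elim: n {IHn} => //= n; rewrite rt_dart.
move=> d Dd; have [p pp] := connected_path d0.1 d.1.
elim: p d0 Dd0 P0 pp => [|z p IHp] d0 Dd0 P0 /=.
  by move=> _ ed; apply: Ptail P0.
case/andP => ez pp lastE.
apply: (IHp (swap (d0.1, z))) => //; first by rewrite dart_swap dartE.
by apply: Psw; rewrite ?dartE //; apply: (Ptail d0); rewrite ?dartE.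
Qed.

(** * Face boundaries and closed walks over F_2 *)

Section Colouring.
Local Open Scope ring_scope.

Definition edge_of (d : T * T) : {set T} := [set d.1; d.2].

Lemma edge_of_eq x y d : (edge_of d == [set x; y]) = (d == (x, y)) || (d == (y, x)).
Proof.
case: d => a b; rewrite /edge_of /=; apply/eqP/orP => [eqs|]; last first.
  by case=> /eqP [-> ->] //; rewrite setUC.
have: a \in [set x; y] by rewrite -eqs set21.
have: b \in [set x; y] by rewrite -eqs set22.
have: x \in [set a; b] by rewrite eqs set21.
have: y \in [set a; b] by rewrite eqs set22.
rewrite !inE !xpair_eqE.
by do 4![case/orP => /eqP ?; subst]; rewrite ?eqxx; auto.
Qed.

Lemma edge_of_in d : d \in D -> edge_of d \in edges e.
Proof.
rewrite !inE => ed; apply/existsP; exists d.1; apply/existsP; exists d.2.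
by rewrite ed /edge_of eqxx.
Qed.

Lemma edgesP p : reflect (exists2 d, d \in D & p = edge_of d) (p \in edges e).
Proof.
apply: (iffP idP) => [|[d Dd ->]]; last exact: edge_of_in.
rewrite inE => /existsP [x /existsP [y /andP [xy /eqP ->]]].
by exists (x, y); rewrite ?inE.
Qed.

Lemma e_neq x y : e x y -> x != y.
Proof. by move=> xy; apply: contraTneq xy => ->; rewrite e_irr. Qed.

Lemma sum_edge (V : zmodType) (g : T * T -> V) x y : e x y ->
  \sum_(d in D | edge_of d == [set x; y]) g d = g (x, y) + g (y, x).
Proof.
move=> xy; have nxy := e_neq xy.
rewrite (bigD1 (x, y)) /=; last by rewrite dartE xy edge_of_eq eqxx.
congr (_ + _); apply: big_pred1 => d /=; rewrite edge_of_eq.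
case: (d =P (y, x)) => [->|/eqP nd] /=.
  by rewrite dartE e_sym xy xpair_eqE (negPf nxy) andbF orbT.
by case: eqP => [->|_]; rewrite ?andbF.
Qed.

Lemma card_darts : #|D| = (2 * nedges e)%N.
Proof.
have sum1 : \sum_(p in edges e) \sum_(d in D | edge_of d == p) 1 = \sum_(d in D) 1 :> int.
  by rewrite [RHS](partition_big edge_of (mem (edges e))) //= => d /edge_of_in.
have : \sum_(p in edges e) \sum_(d in D | edge_of d == p) 1 = \sum_(p in edges e) 2 :> int.
  by apply: eq_bigr => p /edgesP [[x y] Dd ->]; rewrite sum_edge // -dartE.
rewrite sum1 !sumr_const /nedges -[2 *+ _]mulr_natr -natrM => /eqP.
by rewrite eqr_nat => /eqP.
Qed.

Let Es := edges e.
Let Rs := [set d in D | froots fp d].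
Let m := #|Es|.
Let f := #|Rs|.
Let n := #|T|.

Let eqf : f = nfaces e rt.
Proof. by apply: eq_card => d; rewrite inE [RHS]inE /= andbC. Qed.

Let eqm : (n + f = m + 2)%N.
Proof.
by have := euler; rewrite card_darts -eqf -/(nedges e) -/n -/m /nedges -/Es -/m; lia.
Qed.

Local Notation ev := (@enum_val _ (mem Es)).
Local Notation fv := (@enum_val _ (mem Rs)).
Local Notation vv := (@enum_val _ (mem T)).

Let M : 'M['F_2]_(m, n) := \matrix_(i, j) (vv j \in ev i)%:R.
(** The boundary matrix of the faces: an entry counts the darts of an edge on a face, so an edge
    with the same face on both sides contributes 1 + 1 = 0. *)
Let B : 'M['F_2]_(f, m) :=
  \matrix_(i, j) \sum_(d in D | edge_of d == ev j) (froot fp d == fv i)%:R.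

Let addF2 (a : 'F_2) : a + a = 0.
Proof. by case: a => [[|[|a]] ha] //; apply: val_inj. Qed.

Let froot_fp d : froot fp (fp d) = froot fp d.
Proof.
have sc := fconnect_sym fp_inj.
by apply/eqP; rewrite (root_connect sc) sc fconnect1.
Qed.

Let BM : B *m M = 0.
Proof.
apply/matrixP => i w; rewrite !mxE.
transitivity (\sum_(p in Es) \sum_(d in D | edge_of d == p)
    (froot fp d == fv i)%:R * (vv w \in edge_of d)%:R : 'F_2).
  rewrite [RHS]big_enum_val; apply: eq_bigr => j _; rewrite !mxE mulr_suml.
  by apply: eq_bigr => d /andP [_ /eqP ->].
rewrite -(partition_big edge_of (mem Es) (P := mem D) (F := fun d => (froot fp d == fv i)%:R * (vv w \in edge_of d)%:R)) /=; last exact: edge_of_in.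
transitivity (\sum_(d in D) ((froot fp d == fv i)%:R * (d.1 == vv w)%:R
   + (froot fp d == fv i)%:R * (d.2 == vv w)%:R) : 'F_2).
  apply: eq_bigr => d; rewrite inE => /e_neq nd.
  rewrite -mulrDr -natrD !inE; congr (_ * _%:R).
  rewrite ![vv w == _]eq_sym.
  by case: (d.1 =P vv w) nd => [->|_] nd; rewrite ?orbT //= eq_sym (negPf nd).
(* The tail of [fp d] is the head of [d] and the face is the same: each face enters a vertex as
   often as it leaves it. *)
rewrite big_split /= [X in X + _](reindex_inj fp_inj) /=.
rewrite (eq_bigl (mem D)); last by move=> d /=; rewrite fp_dart.
rewrite -big_split /= big1 // => d Dd.
by rewrite froot_fp fp_tail // addF2.
Qed.

Let root_fv k : froot fp (fv k) = fv k.
Proof. by have := enum_valP k; rewrite !inE => /andP [_ /eqP]. Qed.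

(** A combination y of faces read as a colouring of darts: the coefficient of the face containing
    d. *)
Let col (y : 'rV['F_2]_f) d : 'F_2 := \sum_i y 0 i * (froot fp d == fv i)%:R.

Let col_fp y d : col y (fp d) = col y d.
Proof. by rewrite /col froot_fp. Qed.

Let colB y (j : 'I_m) a b : e a b -> ev j = [set a; b] ->
  (y *m B) 0 j = col y (a, b) + col y (b, a).
Proof.
move=> ab jE; rewrite -sum_edge // /col exchange_big /= mxE.
by apply: eq_bigr => i _; rewrite mxE jE mulr_sumr.
Qed.

Let edge_index a b : e a b -> exists j : 'I_m, ev j = [set a; b].
Proof.
move=> ab; have abE : [set a; b] \in Es by apply: (edge_of_in (d := (a, b))); rewrite inE.
by exists (enum_rank_in abE [set a; b]); rewrite enum_rankK_in.
Qed.

Let some_dart : exists d, d \in D.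
Proof.
have [x [y [_ _ nxy]]] : exists x y : T, [/\ x \in T, y \in T & x != y].
  by move: T_gt1; rewrite -cardsT => /card_gt1P [x [y [? ? ?]]]; exists x, y; split; rewrite ?inE.
have [[|z p] /= pp lE] := connected_path x y; first by rewrite lE eqxx in nxy.
by exists (x, z); rewrite dartE; case/andP: pp.
Qed.

(** A vector in the left kernel of [B] gives both sides of every edge the same coefficient, so it is
    constant by [dart_ind], and the kernel has dimension at most 1. *)
Let rankB : (f <= \rank B + 1)%N.
Proof.
have: (kermx B <= (const_mx 1 : 'rV_f))%MS.
  apply/row_subP => i.
  have: row i (kermx B) *m B = 0 by rewrite -row_mul mulmx_ker row0.
  move: (row i _) => y yB.
  have [d0 Dd0] := some_dart.
  have colc d : d \in D -> col y d = col y d0.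
    apply: (dart_ind (P := fun d => col y d = col y d0) Dd0) => //.
      move=> [a b]; rewrite dartE => ab <-; have [j jE] := edge_index ab.
      have := colB y ab jE; rewrite yB mxE => /esym /eqP; rewrite addr_eq0 => /eqP ->.
      by apply/eqP; rewrite -addr_eq0 addF2.
    by move=> d' _; rewrite col_fp.
  suff [a ->] : exists a, y = a *: const_mx 1 by exact: scalemx_sub.
  exists (col y d0).
  apply/rowP => k; rewrite !mxE mulr1 -(colc (fv k)); last first.
    by have := enum_valP k; rewrite inE => /andP [].
  rewrite /col (bigD1 k) //= big1 => [|l nl]; last first.
    by rewrite root_fv (inj_eq enum_val_inj) eq_sym (negPf nl) mulr0.
  by rewrite root_fv eqxx mulr1 addr0.
move/mxrankS; rewrite mxrank_ker => h.
by have := leq_trans h (rank_leq_row _); lia.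
Qed.

(** A vector in the kernel is a function on the vertices that agrees at the ends of every edge,
    hence is constant on a connected graph. *)
Let rankM : (n <= \rank M + 1)%N.
Proof.
have: (kermx M^T <= (const_mx 1 : 'rV_n))%MS.
  apply/row_subP => i.
  have: row i (kermx M^T) *m M^T = 0 by rewrite -row_mul mulmx_ker row0.
  move: (row i _) => y yM.
  pose Y x := y 0 (enum_rank x).
  have Yc a b : e a b -> Y a = Y b.
    move=> ab; have [j jE] := edge_index ab.
    have /matrixP /(_ 0 j) := yM; rewrite !mxE => sum0.
    apply: (addIr (Y b)); rewrite addF2 -[RHS]sum0 (bigD1 (enum_rank a)) //= (bigD1 (enum_rank b)) /=; last first.
      by rewrite (inj_eq enum_rank_inj) eq_sym e_neq.
    rewrite big1 => [|k /andP [ka kb]].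
      by rewrite addr0 !mxE jE !enum_rankK set21 set22 !mulr1.
    rewrite !mxE jE !inE.
    have /negPf -> : vv k != a by apply: contraNneq ka => <-; rewrite enum_valK.
    have /negPf -> : vv k != b by apply: contraNneq kb => <-; rewrite enum_valK.
    by rewrite mulr0.
  have [[x0 _] _] := some_dart.
  suff [a ->] : exists a, y = a *: const_mx 1 by exact: scalemx_sub.
  exists (Y x0).
  apply/rowP => k; rewrite !mxE mulr1.
  have -> : y 0 k = Y (vv k) by rewrite /Y enum_valK.
  have [p pp ->] := connected_path x0 (vv k).
  by elim: p x0 pp => //= z p IHp x0 /andP [/Yc -> /IHp].
move/mxrankS; rewrite mxrank_ker mxrank_tr => h.
by have := leq_trans h (rank_leq_row _); lia.
Qed.

Fixpoint traversals x p (s : {set T}) : nat :=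
  if p is y :: p' then (s == [set x; y]) + traversals y p' s else 0.

(** The boundary of a walk modulo 2 telescopes to its two ends; for a closed walk it vanishes. *)
Let walk_ends x p w : path e x p ->
  \sum_(s in Es) (traversals x p s)%:R * (w \in s)%:R = (x == w)%:R + (last x p == w)%:R :> 'F_2.
Proof.
elim: p x => [|y p IHp] x /=; first by rewrite big1 ?addF2 // => s _; rewrite mul0r.
case/andP => xy /IHp IH; under eq_bigr do rewrite natrD mulrDl.
rewrite big_split /= IH (bigD1 [set x; y]) /=; last first.
  by apply: (edge_of_in (d := (x, y))); rewrite inE.
rewrite big1 => [|s /andP [_ /negPf ->]]; last by rewrite mul0r.
rewrite eqxx mul1r addr0 !inE ![w == _]eq_sym.
have := e_neq xy; case: (x =P w) => [->|_]; rewrite /= ?[_ == w]eq_sym.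
  by move/negPf ->; rewrite add0r.
by rewrite addrA addF2 add0r.
Qed.

(* The face boundaries span the cycle space over F_2, by Euler's formula; this is
   the combinatorial Jordan curve theorem. *)
Theorem closed_walk_colouring x0 p : path e x0 p -> last x0 p = x0 ->
  exists c : T * T -> bool,
    (forall d, c (fp d) = c d) /\
    (forall x y, e x y -> c (x, y) (+) c (y, x) = odd (traversals x0 p [set x; y])).
Proof.
move=> pp lp; pose v : 'rV['F_2]_m := \row_j (traversals x0 p (ev j))%:R.
have vM : (v <= kermx M)%MS.
  apply/sub_kermxP/rowP => w; rewrite !mxE.
  have := walk_ends (vv w) pp; rewrite lp addF2; apply: etrans; rewrite [RHS]big_enum_val.
  by apply: eq_bigr => j _; rewrite !mxE.
have BK : (B <= kermx M)%MS by apply/sub_kermxP.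
have [_ KB] := mxrank_leqif_sup BK.
have {KB} : (kermx M <= B)%MS.
  (* The cycle space has dimension m - rank M <= m - n + 1 = f - 1 <= rank B, so the face boundaries
     fill it. *)
  rewrite -KB eqn_leq mxrankS //= mxrank_ker.
  have := rankB; have := rankM; have := eqm; have := rank_leq_row M; have := rank_leq_col M.
  by rewrite -/m -/n; lia.
move/(submx_trans vM)/submxP => [y vy].
exists (fun d => col y d != 0); split=> [d|a b ab]; first by rewrite col_fp.
have [j jE] := edge_index ab; have := colB y ab jE; rewrite -vy mxE jE.
have oddE k : (k%:R != 0 :> 'F_2) = odd k.
  by rewrite -(@Fp_nat_mod 2) // modn2; case: odd.
rewrite -oddE => ->; move: (col y _) (col y _).
by do 2![case=> [[|[|]]] // ?].
Qed.

End Colouring.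

(** * Simple faces and the order of common neighbours *)

Lemma avoiding_path v a b : a != v -> b != v ->
  exists p, [/\ path e a p, last a p = b & v \notin a :: p].
Proof.
move=> av bv; case: conn2 => _ [_ /(_ v a b)]; rewrite !inE => /(_ av bv) /connectP [p pp ->].
exists p; split=> //; first by apply: sub_path pp => x y /= /andP [/andP []].
rewrite inE eq_sym (negPf av) /=; elim: p a {av} pp => //= y p IHp a /andP [/andP [_ yv] /IHp].
by rewrite !inE in yv * => /negPf ->; rewrite eq_sym (negPf yv).
Qed.

Lemma traversals_cat (x : T) p q s :
  traversals x (p ++ q) s = (traversals x p s + traversals (last x p) q s)%N.
Proof. by elim: p x => //= y p IHp x; rewrite IHp addnA. Qed.

Lemma traversals_avoid (x : T) p v z : v \notin x :: p -> traversals x p [set v; z] = 0%N.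
Proof.
elim: p x => //= y p IHp x; rewrite !inE !negb_or => /and3P [vx vy vp].
rewrite IHp ?inE ?negb_or ?vy // addn0; apply/eqP; rewrite eqb0; apply/eqP => eqs.
have: v \in [set x; y] by rewrite -eqs set21.
by rewrite !inE (negPf vx) (negPf vy).
Qed.

Lemma set2_eq (a b c d : T) : ([set a; b] == [set c; d]) = ((a, b) == (c, d)) || ((a, b) == (d, c)).
Proof. exact: (edge_of_eq c d (a, b)). Qed.

Lemma colour_rt c u v : (forall d, c (fp d) = c d) -> e u v -> c (v, nx u v) = c (u, v) :> bool.
Proof. by move=> cfp uv; rewrite -fp_nx // cfp. Qed.

(* A face visiting a vertex twice would have one colour at two corners which
   a closed walk through that vertex separates. *)
Theorem face_simple d d' : d \in D -> d' \in D -> fconnect fp d d' -> d.1 = d'.1 -> d = d'.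
Proof.
case: d d' => v a [v' b]; rewrite !dartE /= => va v'b fdd eqv; rewrite -{v'}eqv in v'b fdd *.
have vb := v'b; apply: contraTeq isT => nab.
have {}nab : a != b by apply: contraNneq nab => ->.
have [p [pp lp vp]] : exists p, [/\ path e a p, last a p = b & v \notin a :: p].
  by apply: avoiding_path; rewrite eq_sym (e_neq).
have walk : path e v (a :: rcons p v) by rewrite /= va rcons_path pp lp e_sym.
have [|c [cfp cE]] := closed_walk_colouring walk.
  by rewrite /= last_rcons.
have {}cE x : e v x -> c (x, v) = c (v, x) (+) ((x == a) (+) (x == b)).
  move=> vx; have := cE v x vx; rewrite /= -cats1 traversals_cat lp /= addn0.
  rewrite traversals_avoid // add0n !set2_eq !xpair_eqE !eqxx /= oddD !oddb.
  have nvx := e_neq vx; rewrite [v == a](negPf (e_neq va)).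
  by rewrite [v == b](negPf (e_neq vb)) /= orbF => <-; rewrite addKb.
(* The closed walk uses only the edges va and vb at v, so the colour changes exactly when the
   rotation passes one of them. *)
have step x : e v x -> c (rt (v, x)) = c (v, x) (+) ((x == a) (+) (x == b)).
  by move=> vx; rewrite -cE // rt_nx // ?colour_rt // e_sym.
have rot_vb : fconnect rt (v, a) (v, b) by case: rtP => _ _; apply; rewrite ?dartE.
have n_lt := findex_max rot_vb; have := iter_findex rot_vb.
move: (findex _ _ _) n_lt (@findex_iter _ rt (v, a)) => n n_lt fx itn.
have cab : c (v, b) = c (v, a).
  have /iter_findex <- := fdd; elim: (findex _ _ _) => //= k <-; exact: cfp.
(* The colour flips on leaving a and stays so until b is reached, whereas va and vb lie on one face
   and have equal colours. *)
have flip i : i < n -> c (iter i.+1 rt (v, a)) = ~~ c (v, a).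
  elim: i => [|i IHi] ltin; first by rewrite /= step // eqxx (negPf nab) addbT.
  rewrite iterS; have := IHi (ltnW ltin).
  have [E1 E2] : (iter i.+1 rt (v, a)).1 = v /\ iter i.+1 rt (v, a) \in D.
    elim: i.+1 => [|k [E1 E2]] /=; first by rewrite dartE.
    by rewrite rt_tail // rt_dart.
  move: (fx i.+1 (ltn_trans ltin n_lt)) E1 E2; case: (iter i.+1 rt (v, a)) => v' x /= fxi E1.
  rewrite {v'}E1 in fxi *; rewrite dartE => vx; rewrite step // => ->.
  have /negPf -> : x != a.
    apply: contra_eqN fxi => /eqP ->.
    by have /= -> := fx 0%N (leq_ltn_trans (leq0n _) n_lt).
  have /negPf -> : x != b.
    apply: contra_eqN fxi => /eqP ->; rewrite -itn fx // neq_ltn ltin orbT //.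
  by case: (c _).
case: n itn flip {n_lt} => [[nab']|n itn /(_ n (ltnSn n))]; first by rewrite nab' eqxx in nab.
by rewrite itn cab; case: (c _).
Qed.

Lemma face_simple_head d d' : d \in D -> d' \in D -> fconnect fp d d' -> d.2 = d'.2 -> d = d'.
Proof.
move=> Dd Dd' fdd eq2; apply: fp_inj; apply: face_simple; rewrite ?fp_dart //.
  by rewrite -(same_fconnect1 fp_inj) -(same_fconnect1_r fp_inj).
by rewrite !fp_tail.
Qed.

(* The triangle u v x separates the plane, and y is on the same side of it seen
   from u and seen from v. *)
Lemma common_order u v p q x y :
  e u v -> uniq (v :: p) -> uniq (u :: q) ->
  {in p, forall z, e u z} -> {in q, forall z, e v z} ->
  fpath (fun z => nx z u) v p -> fpath (fun z => nx z v) u q ->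
  x \in p -> x \in q -> y \in p -> y \in q ->
  index x p < index y p -> index x q < index y q -> False.
Proof.
move=> uv /= /andP [vp up] /andP [uq uq'] ep eq_ fpp fpq xp xq yp yq ltp ltq.
have ux := ep _ xp; have vx := eq_ _ xq; have uy := ep _ yp; have vy := eq_ _ yq.
have nuv := e_neq uv; have nux := e_neq ux; have nvx := e_neq vx.
have nuy := e_neq uy; have nvy := e_neq vy.
have nxy : x != y by apply: contraTneq ltp => ->; rewrite ltnn.
have walk : path e u [:: v; x; u] by rewrite /= uv vx e_sym ux.
have [//|c [cfp cE]] := closed_walk_colouring walk.
have symn (a b : T) : a != b -> (b == a) = false by rewrite eq_sym => /negPf.
have neqs := (eqxx, (negPf nuv, symn _ _ nuv, negPf nux, symn _ _ nux, negPf nvx, symn _ _ nvx),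
  (negPf nuy, symn _ _ nuy, negPf nvy, symn _ _ nvy, negPf nxy, symn _ _ nxy)).
have cuv : c (u, v) (+) c (v, u).
  by rewrite cE //= !set2_eq !xpair_eqE !neqs.
have cy z : e y z -> c (y, z) = c (z, y).
  move=> yz; have := cE y z yz; rewrite /= !set2_eq !xpair_eqE !neqs /=.
  by case: (c _); case: (c _).
(* No edge at y belongs to the triangle, so the colour is constant around y. *)
have cyu : c (y, u) = c (y, v).
  have: fconnect rt (y, u) (y, v) by case: rtP => _ _; apply; rewrite ?dartE // e_sym.
  move/iter_findex; move: (findex _ _ _) => n itn.
  have: (y, u) \in D by rewrite dartE e_sym.
  have: (y, u).1 = y by []. 
  elim: n (y, u) itn => [|n IHn] [y' z] /= itn Ey; first by case: itn => _ ->; rewrite Ey.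
  rewrite {y'}Ey dartE in itn * => yz.
  have zy : e z y by rewrite e_sym.
  rewrite cy // -(colour_rt cfp zy) -(rt_nx zy); apply: IHn; first by rewrite -iterSr.
    by rewrite rt_tail.
  by rewrite rt_dart // dartE.
(* Turning about a from b, the colour flips just after x. As y follows x at both u and v, the darts
   uy and vy get the negated colours of vu and uv. These differ, which contradicts the equal colours
   at y. *)
have key a b s : e a b -> b \notin s -> (a, b) \in [:: (u, v); (v, u)] -> uniq s ->
   {in s, forall z, e a z} -> fpath (fun z => nx z a) b s -> x \in s ->
   {in s, forall z, c (a, z) = c (b, a) (+) (index x s < index z s)}.
  move=> ab bs abE us es; have ba : e b a by rewrite e_sym.
  have step z : z \in s -> c (z, a) = c (a, z) (+) (z == x).
    move=> zs; have az := es _ zs; have nzb : z != b by apply: contraNneq bs => <-.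
    have := cE a z az; rewrite /= !set2_eq !xpair_eqE.
    move: abE; rewrite !inE !xpair_eqE => /orP [] /andP [/eqP Ea /eqP Eb].
      rewrite Ea Eb in nzb az *; rewrite !neqs (negPf nzb) (symn _ _ (e_neq az)) /= ?orbF.
      by case: (z == x); case: (c _); case: (c _).
    rewrite Ea Eb in nzb az *; rewrite !neqs (negPf nzb) (symn _ _ (e_neq az)) /= ?orbF.
    by case: (z == x); case: (c _); case: (c _).
  move=> fps xs; have nthE i : i < size s -> c (a, nth u s i) = c (b, a) (+) (index x s < i).
    elim: i => [|i IHi] lti.
      case: (s) lti fps => //= s0 s' _ /andP [/eqP <- _].
      by rewrite colour_rt // ltn0 addbF.
    have /(pathP u) /(_ i.+1 lti) /= /eqP <- := fps.
    have si : nth u s i \in s by rewrite mem_nth // ltnW.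
    rewrite (colour_rt cfp); last by rewrite e_sym es.
    rewrite (step _ si) (IHi (ltnW lti)) -addbA; congr (addb _ _).
    rewrite ltnS [RHS]leq_eqVlt; case: (index x s =P i) => [<-|/eqP ne].
      by rewrite ltnn nth_index ?eqxx.
    rewrite orFb; suff /negPf -> : nth u s i != x by rewrite addbF.
    by apply: contraNneq ne => <-; rewrite index_uniq // ltnW.
  by move=> z zs; rewrite -{1}(nth_index u zs) nthE ?index_mem.
have vu : e v u by rewrite e_sym.
have m1 : (u, v) \in [:: (u, v); (v, u)] by rewrite inE eqxx.
have m2 : (v, u) \in [:: (u, v); (v, u)] by rewrite !inE eqxx orbT.
have := key u v p uv vp m1 up ep fpp xp y yp; rewrite ltp => Ep.
have := key v u q vu uq m2 uq' eq_ fpq xq y yq; rewrite ltq => Eq.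
have yu : e y u by rewrite e_sym.
have yv : e y v by rewrite e_sym.
have := cyu; rewrite cy // cy // Ep Eq; move: cuv.
by case: (c (u, v)); case: (c (v, u)).
Qed.

(** * Soundness of the local exploration *)

Hypothesis n7 : 7 <= #|T|.
Hypothesis noC7 : ~ has_C7 e.
Hypothesis dense : forall S : {set T}, 0 < #|S| <= 4 ->
  nth 0 [:: 0; 3; 6; 8; 11] #|S| <= #|edges_touching e S|.

Definition fl (d : T * T) := fingraph.order fp d.

Lemma fl_gt0 d : 0 < fl d.
Proof. exact: fingraph.order_gt0. Qed.

Lemma iter_fl d : iter (fl d) fp d = d.
Proof. exact: iter_order fp_inj d. Qed.

Lemma iter_lt_fl i j d : i < fl d -> j < fl d -> iter i fp d = iter j fp d -> i = j.
Proof. by move=> ilt jlt eqij; rewrite -(findex_iter ilt) eqij findex_iter. Qed.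

Lemma fl_same d d' : fconnect fp d d' -> fl d = fl d'.
Proof. by move=> dd'; apply: eq_card => x; rewrite !inE; apply: same_connect dd' x; apply: fconnect_sym fp_inj. Qed.

Lemma fl_fp d : fl (fp d) = fl d.
Proof. by rewrite -(fl_same (fconnect1 fp d)). Qed.

Definition nbrs v := [set u | e v u].

Lemma degree_ge3 v : 3 <= #|nbrs v|.
Proof.
have := dense (S := [set v]); rewrite cards1 /= => /(_ isT) /leq_trans; apply.
apply: leq_trans (leq_imset_card (fun u => [set v; u]) (mem (nbrs v))); apply: subset_leq_card.
apply/subsetP => p; rewrite inE => /andP [/edgesP [[x y] Dd ->]] /existsP [z].
rewrite !inE => /andP [/eqP ->] /orP [] /eqP ->; apply/imsetP; move: Dd; rewrite dartE => xy.
  by exists y; rewrite ?inE.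
by exists x; rewrite ?inE 1?e_sym // /edge_of setUC.
Qed.

Lemma nx_neq u v : e u v -> nx u v != u.
Proof.
move=> uv; apply/eqP => nxu.
have vu : e v u by rewrite e_sym.
have all_u : forall z, e v z -> z \in pred1 u.
  by apply: (rotation_closed (S := pred1 u) vu); rewrite ?inE // => y _; rewrite !inE => /eqP ->; rewrite nxu.
have: nbrs v \subset [set u] by apply/subsetP => z; rewrite !inE => /all_u.
by move/subset_leq_card; rewrite cards1 leqNgt (leq_trans _ (degree_ge3 v)).
Qed.

Lemma fp_neq d : d \in D -> fp d != d.
Proof.
move=> Dd; apply/eqP => fpd; have := fp_tail Dd; rewrite fpd.
by case: d Dd {fpd} => x y; rewrite dartE => /e_neq /= /eqP.
Qed.

Lemma fl_ge3 d : d \in D -> 3 <= fl d.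
Proof.
move=> Dd; move: (fl_gt0 d) (iter_fl d); case: (fl d) => [|[|[|k]]] //= _ fpd.
  by have := fp_neq Dd; rewrite fpd eqxx.
case: d Dd fpd => u v; rewrite dartE => uv.
by rewrite (fp_nx uv) (fp_nx (nx_edge uv)) => -[/eqP]; rewrite (negPf (nx_neq uv)).
Qed.

Lemma fp_iter_dart n d : (iter n fp d \in D) = (d \in D).
Proof. by elim: n => //= n <-; rewrite fp_dart. Qed.

Lemma orbit_tails_uniq d m : d \in D -> m <= fl d -> uniq (map fst (traject fp d m)).
Proof.
move=> Dd mle; rewrite map_inj_in_uniq.
  apply: subseq_uniq (orbit_uniq fp d).
  have -> : fingraph.orbit fp d = traject fp d (fl d) by [].
  by rewrite -(subnKC mle) trajectD prefix_subseq.
move=> x y /trajectP [i _ ->] /trajectP [j _ ->]; apply: face_simple; rewrite ?fp_iter_dart //.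
by rewrite (connect_trans _ (fconnect_iter fp j d)) // (fconnect_sym fp_inj) fconnect_iter.
Qed.

Lemma cycle_C7 (s : seq T) : size s = 7 -> uniq s -> path.cycle e s -> False.
Proof.
move=> s7 us cs; apply: noC7; case: s s7 us cs => [|x0 s] // s7 us cs.
pose t := x0 :: s; exists (fun i : 'I_7 => nth x0 t i); split.
  by move=> i j /eqP; rewrite nth_uniq ?s7 // => /eqP /val_inj.
move=> i; have [i6|i6] := ltnP i 6.
  rewrite inordK modn_small //.
  move: cs => /= /(pathP x0) /(_ i); rewrite size_rcons -cats1.
  have ss : size s = 6 by case: s7.
  by rewrite ss => /(_ (ltnW i6)); rewrite -cat_cons !nth_cat /= ss ltnS (ltnW i6) /t i6.
have -> : i = 6 :> nat by apply/eqP; rewrite eqn_leq i6 -ltnS ltn_ord.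
rewrite modnn inordK //=; move: cs; rewrite /= rcons_path => /andP [_].
by rewrite (last_nth x0); case: s7 => ->.
Qed.

Lemma fl_neq7 d : d \in D -> fl d != 7.
Proof.
move=> Dd; apply/eqP => fl7; apply: (@cycle_C7 (map fst (traject fp d (fl d)))).
- by rewrite size_map size_traject.
- exact: orbit_tails_uniq.
have : fcycle fp (traject fp d (fl d)) := cycle_orbit fp_inj d.
rewrite path.cycle_map; apply: (sub_in_cycle (P := fun x => x \in D)).
  by move=> x y Dx Dy /= /eqP <-; rewrite fp_tail //; move: Dx; rewrite unfold_in inE.
by apply/allP => x /trajectP [i _ ->]; rewrite fp_iter_dart.
Qed.

Lemma memnE x s : memn x s = (x \in s).
Proof. by elim: s => //= y s ->; rewrite eqnE inE; case: eqP. Qed.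

Lemma uniqnE s : uniqn s = uniq s.
Proof. by elim: s => //= y s ->; rewrite memnE; case: (y \in s). Qed.

Lemma memdE d s : memd d s = (d \in s).
Proof.
elim: s => //= d' s ->; rewrite !eqnE inE; case: d d' => a b [a' b'] /=.
by rewrite xpair_eqE; do 2!case: eqP.
Qed.

Lemma uniqdE s : uniqd s = uniq s.
Proof. by elim: s => //= y s ->; rewrite memdE; case: (y \in s). Qed.

Lemma isnilE (X : eqType) (s : seq X) : isnil s = (s == [::]).
Proof. by case: s. Qed.

Lemma get_set t u v x a b : get (set t u v x) a b = if (a == u) && (b == v) then x else get t a b.
Proof.
rewrite /get /set nth_set_nth /=; case: (a =P u) => [->|//].
by rewrite nth_set_nth /=; case: (b =P v).
Qed.

Definition hastype t d : bool :=
  match t with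
  | 0 => true | 1 => 4 <= fl d | 8 => 8 <= fl d
  | 3 => fl d == 3 | 4 => fl d == 4 | 5 => fl d == 5 | 6 => fl d == 6 | _ => false
  end.

Lemma hastype_fp t d d' : fconnect fp d d' -> hastype t d = hastype t d'.
Proof. by move/fl_same => E; rewrite /hastype E. Qed.

Lemma tjoin_sound a b d : hastype a d -> hastype b d ->
  exists2 t, tjoin a b = Some t & hastype t d.
Proof.
case: a => [|[|[|[|[|[|[|[|[|a]]]]]]]]] //=; case: b => [|[|[|[|[|[|[|[|[|b]]]]]]]]] //= ha hb;
 try (by eexists; [reflexivity | done]); exfalso; move: ha hb; lia.
Qed.

(** [rho] interprets names as vertices. [tables] and then [sat] say that every entry of the state is
    true of the given plane map; unknown entries assert nothing. *)
Record tables (s : state) (rho : nat -> T) : Prop := {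
  rho_inj : forall i j, i < K s -> j < K s -> rho i = rho j -> i = j;
  tab_F : forall u v w, F s u v = w.+1 ->
    [/\ u < K s, v < K s, w < K s, e (rho u) (rho v) & nx (rho u) (rho v) = rho w];
  tab_G : forall v w u, G s v w = u.+1 ->
    [/\ u < K s, v < K s, w < K s, e (rho u) (rho v) & nx (rho u) (rho v) = rho w] }.

Definition lists_nbrs (s : state) (rho : nat -> T) v (l : seq nat) : Prop :=
  [/\ v < K s, uniq l, forall x, x \in l -> x < K s /\ e (rho v) (rho x),
      path.cycle (fun a b => nx (rho a) (rho v) == rho b) l &
      forall z, e (rho v) z -> exists2 x, x \in l & z = rho x].

Record sat (s : state) (rho : nat -> T) : Prop := {
  sat_tab :> tables s rho;
  sat_A : forall u v, v \in adj s u -> [/\ u < K s, v < K s & e (rho u) (rho v)];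
  sat_S : forall u v, v \in adj s u -> u \in adj s v;
  sat_U : forall u, uniq (adj s u);
  sat_T : forall u v, hastype (ty s u v) (rho u, rho v);
  sat_C : forall v, cl s v != [::] -> lists_nbrs s rho v (cl s v);
  sat_K : forall u v, ty s u v != 0 -> (u < K s) && (v < K s) }.

Definition rd (rho : nat -> T) (d : nat * nat) : T * T := (rho d.1, rho d.2).

Definition bounded (s : state) (l : seq (nat * nat)) := all (fun d => (d.1 < K s) && (d.2 < K s)) l.

Definition segment s rho d0 (l : seq (nat * nat)) (c : bool) : Prop :=
  [/\ d0 \in D, l != [::], bounded s l, map (rd rho) l = traject fp d0 (size l) &
      size l <= fl d0 /\ (c -> size l = fl d0)].

Lemma back_spec s rho n u v a b a' b' : tables s rho -> back s n u v a b = (a', b') ->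
  [/\ u < K s, v < K s & e (rho u) (rho v)] -> [/\ a < K s, b < K s & e (rho a) (rho b)] ->
  fconnect fp (rho a, rho b) (rho u, rho v) ->
  [/\ a' < K s, b' < K s & e (rho a') (rho b')] /\ fconnect fp (rho a', rho b') (rho u, rho v).
Proof.
move=> tab + huv; elim: n a b => [|n IHn] a b /=; first by case=> <- <-.
case Ec: (G s a b) => [|c]; first by case=> <- <-.
case: ifP => [_ [<- <-] _ _ |_ eqb hab cab]; first by split; last exact: connect0.
have [cK aK bK ca nxc] := tab_G tab Ec.
by apply: IHn eqb _ _ => //; apply: connect_trans cab; rewrite -nxc -fp_nx // fconnect1.
Qed.

Lemma fwd_spec s rho n a b x y l c : tables s rho -> fwd s n a b x y = (l, c) ->
  [/\ x < K s, y < K s & e (rho x) (rho y)] ->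
  exists2 l', l = (x, y) :: l' & [/\ bounded s l, (a, b) \notin l',
    map (rd rho) l = traject fp (rho x, rho y) (size l) &
    c -> iter (size l) fp (rho x, rho y) = (rho a, rho b)].
Proof.
move=> tab; elim: n x y l c => [|n IHn] x y l c /=.
  by case=> <- <- [xK yK xy]; exists [::]; rewrite // /bounded /= xK yK.
case Ew: (F s x y) => [|w].
  by case=> <- <- [xK yK xy]; exists [::]; rewrite // /bounded /= xK yK.
have [xK yK wK xy nxw] := tab_F tab Ew.
have fpxy : fp (rho x, rho y) = (rho y, rho w) by rewrite fp_nx // nxw.
case: ifP => [/andP [/eqP <- /eqP <-] [<- <-] _|nab].
  by exists [::]; rewrite // /bounded /= xK yK fpxy.
case E: fwd => [l1 c1] [<- <-] _.
have [|l' -> [bnd nl' mapE itE]] := IHn _ _ _ _ E.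
  by split=> //; rewrite -nxw nx_edge.
exists ((y, w) :: l') => //; split.
- by move: bnd; rewrite /bounded /= xK yK.
- by rewrite inE negb_or nl' andbT xpair_eqE eq_sym [b == _]eq_sym -!eqnE nab.
- by rewrite /= fpxy -/(map _ _) -/(size _); congr cons; rewrite -[RHS]mapE.
by move=> /itE <-; rewrite -fpxy -iterSr.
Qed.

Lemma seg_spec s rho u v l c : tables s rho -> seg s u v = (l, c) ->
  [/\ u < K s, v < K s & e (rho u) (rho v)] ->
  exists2 d0, segment s rho d0 l c & fconnect fp d0 (rho u, rho v).
Proof.
move=> tab; rewrite /seg; case E: back => [a b] segE huv.
have [[aK bK ab] cab] := back_spec tab E huv huv (connect0 _ _).
have [|l' lE [bnd nl' mapE itE]] := fwd_spec tab segE; first by split.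
exists (rho a, rho b) => //.
have szle : size l <= fl (rho a, rho b).
  (* A list longer than the face would meet the dart ab again after one full turn, but [fwd] stops
     before repeating it. *)
  rewrite leqNgt; apply/negP => flt.
  have: nth (rho a, rho b) (map (rd rho) l) (fl (rho a, rho b)) = (rho a, rho b).
    by rewrite mapE nth_traject // iter_fl.
  rewrite (nth_map (0, 0)) // lE -(prednK (fl_gt0 _)) /=.
  set d := nth _ _ _ => rdd; case/negP: nl'.
  have dl : d \in l' by rewrite mem_nth // -ltnS prednK ?fl_gt0 //; move: flt; rewrite lE.
  have /andP [d1 d2] : (d.1 < K s) && (d.2 < K s).
    by move: bnd; rewrite lE => /allP; apply; rewrite inE dl orbT.
  case: d dl d1 d2 rdd => d1 d2 /= dl d1K d2K [r1 r2].
  by rewrite -(rho_inj tab d1K aK r1) -(rho_inj tab d2K bK r2).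
split; rewrite ?dartE //; first by rewrite lE.
split=> // /itE itl; apply/eqP; rewrite eqn_leq szle leqNgt; apply/negP => slt.
have := iter_lt_fl slt (fl_gt0 _) itl; by rewrite lE.
Qed.

Lemma face_ok_sound s rho d0 l c t : tables s rho -> segment s rho d0 l c ->
  hastype t d0 -> face_ok l c t.
Proof.
move=> tab [Dd l0 bnd mapE [szle cE]] ht; rewrite /face_ok uniqnE.
have tailsE : map rho (map fst l) = map fst (traject fp d0 (size l)).
  by rewrite -mapE -!map_comp; apply: eq_map.
have -> : uniq (map fst l).
  by apply: (@map_uniq _ _ rho); rewrite tailsE; apply: orbit_tails_uniq.
set h := last 0 _; set m := size l; set h0 := head 0 _.
have sz_gt0 : 0 < m by rewrite /m; case: (l) l0.
have rdE i : i < m -> rd rho (nth (0, 0) l i) = iter i fp d0.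
  by move=> im; rewrite -(nth_map _ d0) // mapE nth_traject.
have hlast : h = (nth (0, 0) l m.-1).2.
  by rewrite nth_last /h -[0]/((0, 0).2 : nat) last_map.
have hhead : h0 = (nth (0, 0) l 0).1 by rewrite /h0; case: (l).
have hE : rho h = (iter m fp d0).1.
  rewrite hlast -[in RHS](prednK sz_gt0) iterS -rdE ?prednK // fp_tail //.
  by rewrite rdE ?prednK // fp_iter_dart.
have h0E : rho h0 = d0.1 by rewrite hhead -[d0]/(iter 0 fp d0) -rdE.
have nthK i : i < m -> ((nth (0, 0) l i).1 < K s) && ((nth (0, 0) l i).2 < K s).
  by move=> im; have /allP := bnd; apply; apply: mem_nth.
have m1 : m.-1 < m by rewrite prednK.
have hK : h < K s by rewrite hlast; case/andP: (nthK _ m1).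
have h0K : h0 < K s by rewrite hhead; case/andP: (nthK _ sz_gt0).
have simple i j : (iter i fp d0).1 = (iter j fp d0).1 -> iter i fp d0 = iter j fp d0.
  apply: face_simple; rewrite ?fp_iter_dart //.
  by rewrite (connect_trans _ (fconnect_iter fp j d0)) // (fconnect_sym fp_inj) fconnect_iter.
case: ifP => [c_or|].
  have m_eq : m = fl d0.
    case/orP: c_or => [/cE //|/eqP hh0].
    apply/eqP; rewrite eqn_leq szle leqNgt; apply/negP => mlt.
    have /(iter_lt_fl mlt (fl_gt0 _)) m0 : iter m fp d0 = iter 0 fp d0.
      by apply: simple; rewrite -hE hh0 h0E.
    by rewrite m0 in sz_gt0.
  by move: ht; rewrite /hastype; case: t => [|[|[|[|[|[|[|[|[|t]]]]]]]]] //; rewrite m_eq // => /eqP ->.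
move/negbT; rewrite negb_or eqnE => /andP [_ hh0].
have mlt : m < fl d0.
  rewrite ltn_neqAle szle andbT; apply: contraNneq hh0 => m_eq.
  by rewrite (rho_inj tab hK h0K _) // hE m_eq iter_fl h0E.
have -> : memn h (map fst l) = false.
  rewrite memnE; apply/negP => /mapP [d /(nthP (0, 0)) [i im <-] hd].
  have /(iter_lt_fl mlt (ltn_trans im mlt)) mi : iter m fp d0 = iter i fp d0.
    by apply: simple; rewrite -hE hd -rdE.
  by have := im; rewrite -mi ltnn.
by move: ht; rewrite /hastype; case: t => [|[|[|[|[|[|[|[|[|t]]]]]]]]] // => /eqP <-.
Qed.

Lemma sat_set_types s s0 rho l c t d0 : K s0 = K s -> sat s rho -> segment s0 rho d0 l c -> hastype t d0 ->
  sat (set_types s l t) rho.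
Proof.
move=> eqK [tab sA sS sU sT sC sK] [Dd l0 bnd mapE _] ht.
have: all (fun d => hastype t (rd rho d)) l.
  apply/allP => d dl; have: rd rho d \in map (rd rho) l by apply: map_f.
  by rewrite mapE => /trajectP [i _ ->]; rewrite -(hastype_fp t (fconnect_iter fp i d0)).
have: bounded s l by rewrite /bounded -eqK.
rewrite /bounded => {mapE l0 bnd} bl hl.
have tyP u v : hastype (ty (set_types s l t) u v) (rho u, rho v) /\
    (ty (set_types s l t) u v != 0 -> (u < K s) && (v < K s)).
  rewrite /ty /set_types /=; elim: l bl hl => [|[a b] l IHl] /=; first by split; [exact: sT | exact: sK].
  case/andP => kab /IHl {}IHl /andP [hab /IHl IH]; rewrite get_set.
  by case: ifP => // /andP [/eqP -> /eqP ->].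
split=> //; first by case: tab.
  by move=> u v; case: (tyP u v).
by move=> u v; case: (tyP u v).
Qed.

Lemma set_type_sound s rho u v t : sat s rho -> [/\ u < K s, v < K s & e (rho u) (rho v)] ->
  hastype t (rho u, rho v) ->
  exists2 s', set_type s u v t = Some s' & sat s' rho /\ K s' = K s.
Proof.
move=> sats huv ht; have [t' tE ht'] := tjoin_sound (sat_T sats u v) ht.
rewrite /set_type tE; case segE: seg => [l c].
have [d0 sg d0uv] := seg_spec sats segE huv.
have ht0 : hastype t' d0 by rewrite (hastype_fp _ d0uv).
rewrite (face_ok_sound sats sg ht0); eexists; first by [].
by split=> //; apply: sat_set_types _ _ sg ht0.
Qed.

Lemma ext_sound s rho a n vis cur goal :
  (forall u v, v \in nth [::] a u -> [/\ u < K s, v < K s & e (rho u) (rho v)]) ->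
  ext a n vis cur goal ->
  exists p, [/\ size p = n, all (gtn (K s)) p, path e (rho cur) (map rho p),
     e (rho (last cur p)) (rho goal) & uniq p /\ {in p, forall x, x \notin vis}].
Proof.
move=> aE; elim: n vis cur => [|n IHn] vis cur /=.
  by rewrite memnE => /aE [_ _ cg]; exists [::].
case/hasP => z /aE [_ zK cz]; rewrite memnE; case: ifP => // zvis.
case/IHn => p [sp bp pp lp [up pvis]]; exists (z :: p); split=> //=; rewrite ?sp ?cz ?zK //.
split=> [|x]; first by rewrite up andbT; apply/negP => /pvis; rewrite inE eqxx.
by rewrite inE => /orP [/eqP ->|/pvis]; rewrite ?zvis // inE negb_or => /andP [].
Qed.

Lemma add_edge_sound s rho u v : sat s rho -> [/\ u < K s, v < K s & e (rho u) (rho v)] ->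
  exists2 s', add_edge s u v = Some s' &
   [/\ sat s' rho, K s' = K s, v \in adj s' u, Ft s' = Ft s & [/\ Gt s' = Gt s, Tt s' = Tt s & Ct s' = Ct s]].
Proof.
move=> sats [uK vK uv]; rewrite /add_edge eqnE.
have nuv : u != v by apply: contraTneq uv => ->; rewrite e_irr.
rewrite (negPf nuv) memnE; case: ifP => [vA|vA]; first by exists s.
have clE a b : a < K s -> b < K s -> e (rho a) (rho b) -> isnil (cl s a) || memn b (cl s a).
  move=> aK bK ab; rewrite isnilE memnE; case: eqP => //= /eqP /(sat_C sats) [_ _ lK _ full].
  have [x xl rx] := full _ ab; rewrite (rho_inj sats bK (proj1 (lK x xl)) rx) //.
rewrite clE // clE //; last by rewrite e_sym.
set A' := set_nth _ _ v _.
have A'E x : nth [::] A' x = (if x == v then [:: u] else if x == u then [:: v] else [::]) ++ adj s x.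
  rewrite /A' nth_set_nth /=; case: (x =P v) => [->|nxv].
    by rewrite nth_set_nth /= eq_sym (negPf nuv).
  by rewrite nth_set_nth /=; case: (x =P u) => [->|].
have A'P x y : y \in nth [::] A' x -> [/\ x < K s, y < K s & e (rho x) (rho y)].
  rewrite A'E mem_cat => /orP [|/(sat_A sats) //].
  case: (x =P v) => [->|_]; first by rewrite inE => /eqP ->; split=> //; rewrite e_sym.
  by case: (x =P u) => [->|//]; rewrite inE => /eqP ->.
case: ifP => [/(ext_sound A'P) [p [sp bp pp lp [up pvis]]]|_].
  have inj x y : x \in u :: v :: p -> y \in u :: v :: p -> rho x = rho y -> x = y.
    have bnd z : z \in u :: v :: p -> z < K s.
      by rewrite !inE => /or3P [/eqP ->|/eqP ->|] //; move/allP: bp; apply.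
    by move=> /bnd xK /bnd yK; apply: (rho_inj sats).
  exfalso; apply: (@cycle_C7 (map rho (u :: v :: p))).
  - by rewrite size_map /= sp.
  - rewrite map_inj_in_uniq //= up andbT inE (negPf nuv) /=.
    by apply/andP; split; apply/negP => /pvis; rewrite !inE eqxx ?orbT.
  - by rewrite /= uv rcons_path pp last_map lp.
eexists; first by []; split=> //=; last first.
  by rewrite /adj /= -/A' A'E (negPf nuv) eqxx mem_cat inE eqxx.
have A'M x y : (y \in nth [::] A' x) = [|| (x == u) && (y == v), (x == v) && (y == u) | y \in adj s x].
  rewrite A'E mem_cat; case: (x =P v) => [->|_]; last by case: (x =P u); rewrite ?inE.
  by rewrite eq_sym (negPf nuv) !inE.
case: (sats) => tab sA sS sU sT sC sK; split=> //; first by case: tab.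
  move=> x y; rewrite /adj /= -/A' !A'M.
  by case/or3P => [/andP [/eqP -> /eqP ->]|/andP [/eqP -> /eqP ->]|/sS ->]; rewrite ?eqxx ?orbT.
move=> x; rewrite /adj /= -/A' A'E; case: (x =P v) => [->|_] /=.
  by rewrite sU andbT; apply/negP => /sS; rewrite vA.
by case: (x =P u) => [->|_] /=; rewrite sU // andbT vA.
Qed.

Lemma index_map_in (X Y : eqType) (f : X -> Y) x (p : seq X) :
  {in x :: p &, injective f} -> index (f x) (map f p) = index x p.
Proof.
elim: p => //= y p IHp inj; rewrite (inj_in_eq inj) ?inE ?eqxx ?orbT //.
rewrite IHp // => a b aP bP; apply: inj; [move: aP | move: bP]; rewrite !inE => /orP [] ->;
  by rewrite ?orbT.
Qed.

Lemma rotation_spec s n v x u : rotation s n v x u != [::] ->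
  exists r, [/\ rotation s n v x u = x :: r, last x r = u & path (fun a b => F s a v == b.+1) x r].
Proof.
elim: n x => //= n IHn x; rewrite eqnE.
case: (x =P u) => [<- _|_]; first by exists [::].
case E: (F s x v) => [|y] //; rewrite isnilE; case: (rotation s n v y u =P [::]) => [_ //|/eqP /IHn [r [-> lr pr]] _].
by exists (y :: r); rewrite /= E eqxx.
Qed.

(** The known step from u back to w closes the list to a cycle under the rotation at v, so by
    [rotation_closed] no neighbour is missing. *)
Lemma rotation_nbrs s rho v w u : tables s rho -> F s u v = w.+1 ->
  rotation s 14 v w u != [::] -> uniq (rotation s 14 v w u) ->
  lists_nbrs s rho v (rotation s 14 v w u).
Proof.
move=> tab Fuv /rotation_spec [r [-> lr pr]] ur.
have cyc : path.cycle (fun a b => F s a v == b.+1) (w :: r).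
  by rewrite /= rcons_path pr lr Fuv eqxx.
have Fr x : x \in w :: r -> exists2 y, y \in w :: r & F s x v = y.+1.
  by move=> xr; exists (next (w :: r) x); rewrite ?mem_next //; apply/eqP/(next_cycle cyc).
have [_ vK wK uv nxw] := tab_F tab Fuv.
split=> // [x /Fr [y _ /(tab_F tab) [xK _ _ xv _]]||z vz].
- by rewrite e_sym.
- apply: sub_cycle cyc => a b /= /eqP /(tab_F tab) [_ _ _ _ ->] //.
suff /mapP : z \in map rho (w :: r) by [].
have wr : rho w \in map rho (w :: r) by apply: map_f; rewrite mem_head.
apply: (rotation_closed (S := mem (map rho (w :: r))) _ wr _ vz).
  by rewrite -nxw nx_edge.
move=> y _ /mapP [x /Fr [y' y'r /(tab_F tab) [_ _ _ _ nxE]] ->].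
by rewrite nxE; apply: (map_f rho y'r).
Qed.

Lemma sat_closed s rho v : sat s rho -> closed s v -> lists_nbrs s rho v (cl s v).
Proof. by move=> sats; rewrite /closed isnilE; apply: sat_C. Qed.

Fixpoint touching_edges s (rho : nat -> T) (S : seq nat) : seq {set T} :=
  if S is v :: S' then
    [seq [set rho v; rho w] | w <- cl s v & ~~ memn w S'] ++ touching_edges s rho S'
  else [::].

Lemma touch_bound s rho S : sat s rho -> all (closed s) S ->
  #|edges_touching e [set x in map rho S]| <= touch s S.
Proof.
move=> sats cS; have -> : touch s S = size (touching_edges s rho S).
  by elim: S {cS} => //= v S ->; rewrite size_cat size_map size_filter.
apply: leq_trans (card_size _); apply: subset_leq_card; apply/subsetP => p.
rewrite inE => /andP [pe /existsP [z /andP []]]; rewrite inE => /mapP [x xS ->] {z}.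
elim: S x cS xS => //= v S IHS x /andP [cv cS] xS xp; rewrite mem_cat.
have [xS'|xS'] := boolP (x \in S); first by rewrite (IHS x) ?orbT.
have {xS xS'} xv : x = v by move: xS; rewrite inE (negPf xS') orbF => /eqP.
rewrite {x}xv in xp; have [_ _ _ _ full] := sat_closed sats cv.
have [z vz pE] : exists2 z, e (rho v) z & p = [set rho v; z].
  move/edgesP: pe => [[a b]]; rewrite dartE /edge_of /= => ab pE; move: xp; rewrite pE !inE.
  by case/orP => /eqP ->; [exists b | exists a; rewrite 1?e_sym // setUC].
have [w wl zE] := full _ vz.
have [wS|wS] := boolP (w \in S).
  by rewrite (IHS w) ?orbT // pE zE set22.
by rewrite pE zE (map_f (fun w => [set rho v; rho w])) // mem_filter memnE wS.
Qed.

Lemma no_sparse s rho need S l : sat s rho ->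
  need = drop (size S) [:: 0; 3; 6; 8; 11] -> 0 < size S ->
  uniq (S ++ l) -> all (closed s) (S ++ l) -> some_sparse s need S l = false.
Proof.
move=> sats; elim: need S l => //= b need IHn S l needE S0 ul cl_Sl.
have S4 : size S <= 4.
  by rewrite leqNgt; apply: contra_eqN needE => S5; rewrite drop_oversize.
have bE : b = nth 0 [:: 0; 3; 6; 8; 11] (size S).
  by rewrite -[size S]addn0 -nth_drop -needE.
have nE : need = drop (size S).+1 [:: 0; 3; 6; 8; 11].
  by rewrite -add1n -drop_drop -needE /= drop0.
have SK x : x \in S ++ l -> x < K s.
  by move/(allP cl_Sl)/(sat_closed sats) => [].
have -> : touch s S < b = false.
  apply/negbTE; rewrite -leqNgt bE.
  move: ul cl_Sl; rewrite cat_uniq all_cat => /and3P [uS _ _] /andP [cS _].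
  apply: leq_trans (touch_bound sats cS).
  have cardS : #|[set x in map rho S]| = size S.
    rewrite cardsE (card_uniqP _) ?size_map // map_inj_in_uniq // => x y xS yS.
    by apply: (rho_inj sats); apply: SK; rewrite mem_cat ?xS ?yS.
  by rewrite -[size S]cardS; apply: dense; rewrite cardS S0.
elim: l ul cl_Sl {SK} => //= x l IHl ul cSl.
have perm : perm_eq (S ++ x :: l) ((x :: S) ++ l) by rewrite /= perm_catC /= perm_cons perm_catC.
rewrite IHn ?IHl //.
- by move: ul; rewrite (perm_uniq perm) /= => /andP [].
- by move: cSl; rewrite (perm_all _ perm) /= => /andP [].
- by rewrite -(perm_uniq perm).
- by rewrite -(perm_all _ perm).
Qed.

(** As the graph has at least seven vertices, some vertex z is unnamed. A path from v to z, chosen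
    to avoid the open vertex if there is one, runs through closed vertices as long as it stays among
    the named ones, and so never leaves them. *)
Lemma not_small s rho v : sat s rho -> closed s v -> 
  (K s <= 6) && (K s <= (size (filter (closed s) (iota 0 (K s)))).+1) = false.
Proof.
move=> sats cv; apply/negP => /andP [K6 Kc].
have [vK _ _ _ _] := sat_closed sats cv.
pose I := [set x in map rho (iota 0 (K s))].
have [z zI] : exists z, z \notin I.
  apply/existsP; rewrite -negb_forall; apply/negP => /forallP allI.
  have: #|T| <= #|I| by apply: subset_leq_card; apply/subsetP => x _; apply: allI.
  rewrite leqNgt => /negP; apply; apply: leq_ltn_trans n7.
  by rewrite cardsE (leq_trans (card_size _)) // size_map size_iota.
have inI i : i < K s -> rho i \in I by move=> iK; rewrite inE map_f // mem_iota.
have step i y : closed s i -> e (rho i) y -> exists2 j, j < K s & y = rho j.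
  by move=> /(sat_closed sats) [_ _ lK _ full] /full [j /lK [jK _] ->]; exists j.
have leave p i : path e (rho i) p -> last (rho i) p = z ->
    (forall j, j < K s -> rho j \in rho i :: p -> closed s j) -> i < K s -> False.
  elim: p i => [|y p IHp] i /=; first by move=> _ iz _ iK; move: zI; rewrite -iz inI.
  move=> /andP [iy pp] lz cj iK.
  have [j jK yE] := step i y (cj i iK (mem_head _ _)) iy.
  subst y; apply: IHp pp lz _ jK => k kK kp.
  by apply: cj => //; rewrite inE kp orbT.
have : size (filter (predC (closed s)) (iota 0 (K s))) <= 1.
  rewrite -(leq_add2l (size (filter (closed s) (iota 0 (K s))))) !size_filter count_predC.
  by rewrite size_iota addn1 -size_filter.
case E: (filter _ _) => [|j [|? ?]] // _.
  have [p pp lp] := connected_path (rho v) z.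
  apply: (leave p v) => // j jK _; apply: contraT => nj.
  by have: j \in [::]; rewrite // -E mem_filter /= nj mem_iota.
have : j \in [:: j] by rewrite inE.
rewrite -{1}E mem_filter /= mem_iota => /andP [nj jK].
have vj : rho v != rho j.
  by apply: contraNneq nj => /(rho_inj sats vK jK) <-.
have zj : z != rho j by apply: contraNneq zI => ->; apply: inI.
have [p [pp lp jp]] := avoiding_path vj zj.
apply: (leave p v) => // k kK kp; apply: contraT => nk.
have: k \in [:: j] by rewrite -E mem_filter /= nk mem_iota.
by rewrite inE => /eqP kj; rewrite kj in kp; rewrite kp in jp.
Qed.

Lemma from_spec s rho u v : sat s rho -> lists_nbrs s rho u (cl s u) -> v \in cl s u ->
  [/\ uniq (v :: from v (cl s u)), {subset v :: from v (cl s u) <= cl s u} &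
    fpath (fun z => nx z (rho u)) (rho v) (map rho (from v (cl s u)))].
Proof.
move=> sats [uK ul lK cyc _] vl.
have rE : rot (index v (cl s u)) (cl s u) = v :: from v (cl s u).
  rewrite /from; have : head v (rot (index v (cl s u)) (cl s u)) = v.
    by rewrite -nth0 /rot nth_cat size_drop subn_gt0 index_mem vl nth_drop addn0 nth_index.
  have: size (rot (index v (cl s u)) (cl s u)) != 0 by rewrite size_rot; case: (cl s u) vl.
  by case: (rot _ _) => //= a l _ ->.
split; first by rewrite -rE rot_uniq.
  by move=> x; have := mem_rot (index v (cl s u)) (cl s u) x; rewrite rE => <-.
move: cyc; rewrite -(rot_cycle (index v (cl s u))) rE /= rcons_path => /andP [pp _].
by rewrite path_map; apply: sub_path pp => a b.
Qed.

Lemma no_crossing s rho u v : sat s rho -> closed s u -> closed s v ->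
  u \in cl s v -> v \in cl s u -> crossing s u v = false.
Proof.
move=> sats cu cv uv vu.
have lu := sat_closed sats cu; have lv := sat_closed sats cv.
have [uu su pu] := from_spec sats lu vu; have [uv' sv pv] := from_spec sats lv uv.
have [uK _ luK _ _] := lu; have [vK _ lvK _ _] := lv.
apply/negP => /hasP [x]; rewrite mem_filter memnE => /andP [xb xa].
case/hasP => y; rewrite mem_filter memnE => /andP [yb ya] /andP [lta ltb].
set a := from v _ in uu su pu xa ya lta; set b := from u _ in uv' sv pv xb yb ltb.
have aK z : z \in v :: a -> z < K s by move/su/luK => [].
have bK z : z \in u :: b -> z < K s by move/sv/lvK => [].
have inja : {in v :: a &, injective rho} by move=> ? ? /aK ? /aK ?; apply: (rho_inj sats).
have injb : {in u :: b &, injective rho} by move=> ? ? /bK ? /bK ?; apply: (rho_inj sats).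
have suba z i : z \in a -> i \in z :: a -> i \in v :: a.
  by move=> zm; rewrite !inE => /orP [/eqP ->|->]; rewrite ?zm orbT.
have ida z : z \in a -> index (rho z) (map rho a) = index z a.
  by move=> zm; apply: index_map_in => i j /(suba _ _ zm) im /(suba _ _ zm) jm; apply: inja.
have subb z i : z \in b -> i \in z :: b -> i \in u :: b.
  by move=> zm; rewrite !inE => /orP [/eqP ->|->]; rewrite ?zm orbT.
have idb z : z \in b -> index (rho z) (map rho b) = index z b.
  by move=> zm; apply: index_map_in => i j /(subb _ _ zm) im /(subb _ _ zm) jm; apply: injb.
apply: (@common_order (rho u) (rho v) (map rho a) (map rho b) (rho x) (rho y)) => //.
- by have [] := luK v vu.
- by rewrite -map_cons map_inj_in_uniq.
- by rewrite -map_cons map_inj_in_uniq.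
- by move=> _ /mapP [z za ->]; have [] := luK z (su z _); rewrite // inE za orbT.
- by move=> _ /mapP [z za ->]; have [] := lvK z (sv z _); rewrite // inE za orbT.
- exact: map_f.
- exact: map_f.
- exact: map_f.
- exact: map_f.
- by rewrite !ida.
by rewrite !idb.
Qed.

Lemma close_sound s rho u v w : sat s rho -> F s u v = w.+1 ->
  exists2 s', close s v (rotation s 14 v w u) = Some s' & sat s' rho /\ K s' = K s.
Proof.
move=> sats Fuv; have := rotation_nbrs sats Fuv; move: (rotation s 14 v w u) => r ln.
rewrite /close isnilE uniqnE; case: (r =P [::]) => [_|/eqP r0]; first by exists s.
case: (boolP (uniq r)) => [ur|_]; last by exists s.
move/(_ r0 ur) in ln; rewrite orbF.
have [vK _ lK cyc full] := ln.
have -> : (size r < size (adj s v)) = false.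
  apply/negbTE; rewrite -leqNgt uniq_leq_size ?(sat_U sats) // => x xA.
  have [_ xK vx] := sat_A sats xA; have [y yr] := full _ vx.
  by move/(rho_inj sats xK) => -> //; have [] := lK y yr.
set s' := State _ _ _ _ _ _.
have clE x : cl s' x = if x == v then r else cl s x by rewrite /cl /= nth_set_nth.
have sats' : sat s' rho.
  case: (sats) => tab sA sS sU sT sC sK; split=> //; first by case: tab.
  by move=> x; rewrite clE; case: (x =P v) => [-> _|_ /sC].
have cv : closed s' v by rewrite /closed clE eqxx isnilE.
have -> : bad_closed s' v = false; last by exists s'.
apply/negbTE; rewrite /bad_closed (not_small sats' cv) orFb; apply/norP; split.
  rewrite (no_sparse sats') //.
    rewrite cat_uniq !filter_uniq ?iota_uniq //= ?orbF ?andbT.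
    by apply/hasPn => x; rewrite mem_filter eqnE /= inE => /andP [].
  rewrite all_cat; apply/andP; split; first by rewrite /= cv.
  by apply/allP => x; rewrite mem_filter => /andP [_]; rewrite mem_filter => /andP [].
apply/hasPn => x; rewrite !memnE; case: ifP => // /andP [xv vx].
rewrite mem_filter => /andP [_]; rewrite mem_filter => /andP [cx _].
by rewrite (no_crossing sats').
Qed.

Lemma add_next_sound s rho u v w : sat s rho ->
  [/\ u < K s, v < K s & e (rho u) (rho v)] -> w < K s -> nx (rho u) (rho v) = rho w ->
  exists2 s', add_next s u v w = Some s' & sat s' rho /\ K s' = K s.
Proof.
move=> sats [uK vK uv] wK nxw; rewrite /add_next.
case Fuv: (F s u v) => [|f]; last first.
  have [_ _ fK _] := tab_F sats Fuv; rewrite nxw => /(rho_inj sats wK fK) ->.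
  by rewrite eqnE eqxx; exists s.
rewrite eqnE; case: eqP => [uw|_].
  by have := nx_neq uv; rewrite nxw uw eqxx.
case Gvw: (G s v w) => [|u'].
  have vw : e (rho v) (rho w) by rewrite -nxw nx_edge.
  have [t -> ht] : exists2 t, tjoin (ty s u v) (ty s v w) = Some t & hastype t (rho u, rho v).
    apply: tjoin_sound; rewrite ?(sat_T sats) //.
    by rewrite (@hastype_fp _ _ (fp (rho u, rho v))) ?fconnect1 // fp_nx // nxw (sat_T sats).
  set s3 := State _ _ _ _ _ _.
  have sat3 : sat s3 rho.
    case: (sats) => [[inj tF tG]] sA sS sU sT sC sK; split=> //; split=> //.
      move=> a b c; rewrite /F /= get_set; case: ifP => [/andP [/eqP -> /eqP ->] [<-]|_ /tF] //.
    move=> a b c; rewrite /G /= get_set; case: ifP => [/andP [/eqP -> /eqP ->] [<-]|_ /tG] //.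
  case segE: seg => [l c].
  have [d0 sg d0uv] := seg_spec sat3 segE (And3 uK vK uv).
  have ht0 : hastype t d0 by rewrite (hastype_fp _ d0uv).
  rewrite (face_ok_sound sat3 sg ht0).
  have [s4 -> [sat4 K4 _ F4 _]] := add_edge_sound sat3 (And3 vK wK vw).
  set s5 := (if _ then _ else _).
  have sat5 : sat s5 rho by rewrite /s5; case: ifP => _ //; apply: sat_set_types _ _ sg ht0.
  have F5 : F s5 u v = w.+1.
    have E5 : Ft s5 = Ft s3 by rewrite /s5; case: ifP.
    by rewrite /F E5 /= get_set !eqxx.
  have [s6 -> [sat6 K6]] := close_sound sat5 F5; exists s6 => //; split=> //.
  by rewrite K6 /s5; case: ifP; rewrite /= K4.
have [u'K _ _ u'v nxu'] := tab_G sats Gvw.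
have /(rho_inj sats u'K uK) -> : rho u' = rho u by apply: nx_inj u'v uv _; rewrite nxu'.
by rewrite eqxx; exists s.
Qed.

(** * Weights *)

Definition corners v := #|[set u in nbrs v | fl (u, v) != 3]|.

(* All charges are scaled by 10, so 6 per vertex becomes 60 and 24/l - 17/2 becomes
   240/l - 85; for l >= 8 only -55 of the latter is used, the rest pays for
   the special vertices. *)
Definition amount d : nat :=
  if (8 <= fl (swap d)) then 25 else if fl (swap d) == 6 then 20 else 0.
(** The charge that d takes over from the opposite dart of its 4-face; [amount] depends on the face
    across d. The opposite dart subtracts the same number, see [taken]. *)
Definition give d : nat :=
  let d' := fp (fp d) in
  if (fl d == 4) && ((corners d'.1 == 1) || (corners d'.2 == 1)) then amount d else 0.
(** The special vertex is the head of d. Requiring two corners at its neighbours on the face keeps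
    special vertices from being consecutive, so they can be bypassed independently. *)
Definition special d : bool :=
  [&& 8 <= fl d, corners d.2 == 1, e d.1 (fp d).2, 2 <= corners d.1 & 2 <= corners (fp d).2].

Definition base l : nat := match l with 4 => 25 | 5 => 37 | 6 => 45 | _ => 55 end.

(** A dart carries the share of its head. The charge of a triangle dart is 240/3 - 85 = -5. *)
Definition weight d : rat :=
  (if fl d == 3 then (if corners d.2 == 0%N then 60 / #|nbrs d.2|%:R else 0) - 5
   else 60 / (corners d.2)%:R + (give d)%:R
     - (base (fl d) + (if fl d == 4 then give (fp (fp d)) else 0) + 30 * special d)%N%:R)%R.

Definition brel : rel (T * T) := fun d d' => (d' == swap d) || (fl d == 3) && (d' == fp d).

Lemma corners_gt0 u v : e u v -> fl (u, v) != 3 -> (0 < corners v).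
Proof. by move=> uv fn3; rewrite card_gt0; apply/set0Pn; exists u; rewrite !inE e_sym uv. Qed.

(** Each dart leaving v has a predecessor on its face that enters v. This justifies the second count
    in [rlow]. *)
Lemma corners_out v : (#|[set u in nbrs v | fl (v, u) != 3]| <= corners v).
Proof.
apply: leq_trans (leq_imset_card (fun x => nx x v) (mem [set u in nbrs v | fl (u, v) != 3])).
apply: subset_leq_card; apply/subsetP => u; rewrite !inE => /andP [vu fn3].
have := f_finv fp_inj (v, u); case E: (finv fp (v, u)) => [x y] fxy.
have xy : e x y by rewrite -dartE -fp_dart fxy dartE.
have yv : y = v by have := fp_nx xy; rewrite fxy => -[].
rewrite yv in xy fxy; apply/imsetP; exists x.
  by rewrite !inE e_sym xy -fl_fp fxy.
by have := fp_nx xy; rewrite fxy => -[].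
Qed.

Lemma hastype_outer t d : hastype t d -> outer_type t = (t != 0) && (fl d != 3).
Proof.
by case: t => [|[|[|[|[|[|[|[|[|t]]]]]]]]] //=; [| move=> -> | move/eqP -> ..|]; move: (fl d); lia.
Qed.

Lemma rlow_le s rho v : sat s rho -> (rlow s v <= corners (rho v)).
Proof.
move=> sats; rewrite /rlow geq_max -!size_filter.
have bound (P : pred nat) (S : {set T}) : {in [seq u <- adj s v | P u], forall u, rho u \in S} ->
    (size [seq u <- adj s v | P u] <= #|S|).
  move=> PS; rewrite -(size_map rho) -(card_uniqP _).
    by apply: subset_leq_card; apply/subsetP => _ /mapP [u /PS uS ->].
  rewrite map_inj_in_uniq ?filter_uniq ?(sat_U sats) // => x y.
  rewrite !mem_filter => /andP [_ /(sat_A sats) [_ xK _]] /andP [_ /(sat_A sats) [_ yK _]].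
  exact: (rho_inj sats).
apply/andP; split.
  apply: bound => u; rewrite mem_filter (hastype_outer (sat_T sats u v)) => /andP [/andP [_ fn3]].
  by move/(sat_A sats) => [_ _ vu]; rewrite !inE vu.
apply: leq_trans (corners_out _); apply: bound => u.
rewrite mem_filter (hastype_outer (sat_T sats v u)) => /andP [/andP [_ fn3]].
by move/(sat_A sats) => [_ _ vu]; rewrite !inE vu.
Qed.

Lemma closed_nbrs s rho v : sat s rho -> closed s v -> nbrs (rho v) = [set x in map rho (cl s v)].
Proof.
move=> sats /(sat_closed sats) [vK ul lK _ full]; apply/setP => z; rewrite !inE; apply/idP/mapP.
  by move/full => [x xl ->]; exists x.
by case=> x /lK [_ vx] ->.
Qed.

Lemma closed_card s rho v (P : pred nat) (Q : pred T) : sat s rho -> closed s v ->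
  {in cl s v, forall u, P u -> Q (rho u)} ->
  (count P (cl s v) <= #|[set u in nbrs (rho v) | Q u]|).
Proof.
move=> sats cv PQ; have [vK ul lK _ full] := sat_closed sats cv.
rewrite -size_filter -(size_map rho) -(card_uniqP _).
  apply: subset_leq_card; apply/subsetP => _ /mapP [u + ->]; rewrite mem_filter => /andP [Pu ul'].
  by rewrite !inE PQ // andbT; have [] := lK u ul'.
rewrite map_inj_in_uniq ?filter_uniq // => x y.
rewrite !mem_filter => /andP [_ /lK [xK _]] /andP [_ /lK [yK _]].
exact: (rho_inj sats).
Qed.

Lemma closed_degree s rho v : sat s rho -> closed s v -> #|nbrs (rho v)| = size (cl s v).
Proof.
move=> sats cv; have [vK ul lK _ full] := sat_closed sats cv.
rewrite (closed_nbrs sats cv) cardsE (card_uniqP _) ?size_map // map_inj_in_uniq // => x y.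
by move=> /lK [xK _] /lK [yK _]; apply: (rho_inj sats).
Qed.

(** [single] leaves room for at most one non-triangular corner, and the dart from u supplies one. *)
Lemma single_sound s rho v u : sat s rho -> single s v -> e u (rho v) -> fl (u, rho v) != 3 ->
  corners (rho v) = 1.
Proof.
move=> sats /andP [cv]; rewrite eqnE => /eqP sz uv fn3.
have le3 : (count (fun u => eqn (ty s u v) 3) (cl s v) <=
    #|[set u in nbrs (rho v) | fl (u, rho v) == 3]|).
  apply: closed_card => // x _; rewrite eqnE => /eqP t3.
  by have := sat_T sats x v; rewrite t3.
have := corners_gt0 uv fn3; have := closed_degree sats cv.
rewrite -(cardsID [set u | fl (u, rho v) == 3]) -/(corners _).
have -> : nbrs (rho v) :&: [set u | fl (u, rho v) == 3] = [set u in nbrs (rho v) | fl (u, rho v) == 3].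
  by apply/setP => x; rewrite !inE.
have -> : nbrs (rho v) :\: [set u | fl (u, rho v) == 3] = [set u in nbrs (rho v) | fl (u, rho v) != 3].
  by apply/setP => x; rewrite !inE andbC.
rewrite -/(corners _); move: le3 sz.
by move: (count _ _) #|_| (corners _) (size _) => a b c d; lia.
Qed.

Lemma opposite_sound s rho u v x y : tables s rho -> opposite s u v = Some (x, y) ->
  fp (fp (rho u, rho v)) = (rho x, rho y) /\ e (rho u) (rho v).
Proof.
move=> tab; rewrite /opposite; case E1: F => [|w] //; case E2: F => [|z] // [<- <-].
have [_ _ _ uv n1] := tab_F tab E1; have [_ _ _ vw n2] := tab_F tab E2.
by rewrite (fp_nx uv) n1 (fp_nx vw) n2.
Qed.

Lemma give_upper_sound s rho u v : sat s rho -> (give (rho u, rho v) <= give_upper s u v)%N.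
Proof.
move=> sats; have := sat_T sats u v; have := sat_T sats v u.
rewrite /give /give_upper /amount /swap /=.
case: ifP => [/andP [/eqP f4 c1]|_]; last by rewrite leq0n.
set a := (if _ then 25 else _) => h' h.
have a25 : a <= 25 by rewrite /a; case: ifP => // _; case: ifP.
have aE : a <= match ty s v u with 0 | 1 | 8 => 25 | 6 => 20 | _ => 0 end.
  move: h' a25; rewrite /a /hastype.
  by case: (ty s v u) => [|[|[|[|[|[|[|[|[|t]]]]]]]]] //= /eqP ->.
move: h; rewrite /hastype f4; case: (ty s u v) => [|[|[|[|[|[|[|[|[|t]]]]]]]]] //= _.
- by move: aE; case: (ty s v u) => [|[|[|[|[|[|[|[|[|t]]]]]]]]].
- by move: aE; case: (ty s v u) => [|[|[|[|[|[|[|[|[|t]]]]]]]]].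
case E: opposite => [[x y]|] //; have [E2 _] := opposite_sound sats E.
move: c1; rewrite E2 /= => c1; case: ifP => // /andP [rx ry].
by have := rlow_le x sats; have := rlow_le y sats; move: c1 rx ry; lia.
Qed.

Lemma fl_fp2 d : fl (fp (fp d)) = fl d.
Proof. by rewrite !fl_fp. Qed.

Lemma give_lower_sound s rho x y : sat s rho -> (give_lower s x y <= give (rho x, rho y))%N.
Proof.
move=> sats; rewrite /give_lower eqnE; case: eqP => // t4.
have := sat_T sats x y; rewrite t4 => /= f4; case E: opposite => [[u v]|] //.
case: ifP => // cuv; have [E2 xy] := opposite_sound sats E.
have uv : e (rho u) (rho v) by rewrite -dartE -E2 !fp_dart dartE.
have fuv : fl (rho u, rho v) = 4 by rewrite -E2 fl_fp2; apply/eqP.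
have nxu : nx (rho x) (rho y) = rho u.
  by move: E2; rewrite (fp_nx xy) (fp_nx (nx_edge xy)) => -[-> _].
have yu : e (rho y) (rho u) by rewrite -nxu nx_edge.
have fyu : fl (rho y, rho u) != 3 by rewrite -nxu -(fp_nx xy) fl_fp (eqP f4).
rewrite /give f4 E2 /=.
have -> : (corners (rho u) == 1) || (corners (rho v) == 1).
  case/orP: cuv => [su|sv]; apply/orP; [left|right]; apply/eqP.
    exact: (single_sound sats su yu fyu).
  by apply: (single_sound sats sv uv); rewrite fuv.
rewrite /amount /swap /=; have := sat_T sats y x; rewrite /hastype.
by case: (ty s y x) => [|[|[|[|[|[|[|[|[|t]]]]]]]]] //=; [move/eqP -> | move=> ->].
Qed.

Lemma special_sound s rho u v : sat s rho -> special_in s u v -> special (rho u, rho v).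
Proof.
move=> sats /and3P []; rewrite eqnE => /eqP t8 sv.
case E: F => [|y] // /and3P [yu r_u ry]; have [_ _ _ uv nxE] := tab_F sats E.
have := sat_T sats u v; rewrite t8 => /= f8.
rewrite /special f8 (fp_nx uv) nxE /= (single_sound sats sv uv) ?eqxx; last by move: f8; lia.
move: yu; rewrite memnE => /(sat_A sats) [_ _ ->].
by rewrite (leq_trans r_u (rlow_le u sats)) (leq_trans ry (rlow_le y sats)).
Qed.

Lemma natr_div_le (k c m : nat) : 0 < c -> k <= m * c -> (k%:R / c%:R <= m%:R :> rat)%R.
Proof. by move=> c0 cm; rewrite ler_pdivrMr ?ltr0n // -natrM ler_nat. Qed.

Lemma base_ge25 l : 25 <= base l.
Proof. by case: l => [|[|[|[|[|[|[|l]]]]]]]. Qed.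

Definition taken d := if fl d == 4 then give (fp (fp d)) else 0.

Lemma taken_sound s rho u v : sat s rho -> fl (rho u, rho v) = 4 ->
  (if opposite s u v is Some (x, y) then give_lower s x y else 0) <= taken (rho u, rho v).
Proof.
move=> sats f4; rewrite /taken f4 eqxx; case E: (opposite s u v) => [[x y]|]; last exact: leq0n.
by have [-> _] := opposite_sound sats E; apply: give_lower_sound.
Qed.

Lemma wneg_sound s rho u v : sat s rho -> fl (rho u, rho v) != 3 -> ty s u v != 0 ->
  wneg s (u, v) <= base (fl (rho u, rho v)) + taken (rho u, rho v) + 30 * special (rho u, rho v).
Proof.
move=> sats fn3 t0; have := sat_T sats u v; rewrite /hastype => ht.
have spE := @special_sound s rho u v sats; have tkE := @taken_sound s rho u v sats.
move: (taken _) (special _) spE tkE => tk sp; rewrite /wneg.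
move: (special_in s u v) => sp0; move: (match opposite s u v with Some _ => _ | None => 0 end) => tk0.
move: (fl (rho u, rho v)) (base_ge25 (fl (rho u, rho v))) fn3 ht => l b25 fn3.
case: (ty s u v) t0 => [|[|[|[|[|[|[|[|[|t]]]]]]]]] //= _.
- by move=> _ _ _; rewrite -addnA (leq_trans b25) ?leq_addr.
- by rewrite (negPf fn3).
- by move=> /eqP -> _ /(_ erefl) tk4; rewrite /base -addnA leq_add2l (leq_trans tk4) ?leq_addr.
- by move=> /eqP -> _ _; rewrite /base -addnA leq_addr.
- by move=> /eqP -> _ _; rewrite /base -addnA leq_addr.
move=> l8 spE _; have -> : base l = 55 by move: l8; case: (l) => [|[|[|[|[|[|[|k]]]]]]].
case: sp0 spE => [/(_ isT) ->|_]; first by rewrite muln1 addnAC leq_addr.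
by rewrite -addnA leq_addr.
Qed.

Lemma wpos_corners k c : 0 < c -> k <= c ->
  (60 / c%:R <= (match k with 0 | 1 => 60 | 2 => 30 | _ => 20 end)%N%:R :> rat)%R.
Proof.
move=> c0 kc; apply: (natr_div_le c0); move: kc; case: k => [|[|[|k]]] kc.
- by rewrite leq_pmulr.
- by rewrite leq_pmulr.
- by rewrite -[60]/(30 * 2)%N leq_mul2l.
by rewrite -[60]/(20 * 3)%N leq_mul2l (leq_trans _ kc).
Qed.

Lemma wpos_degree k : 3 <= k ->
  (60 / k%:R <= (match k with 4 => 15 | 5 => 12 | _ => 20 end)%N%:R :> rat)%R.
Proof.
move=> k3; apply: natr_div_le; first exact: ltnW (ltnW k3).
case: k k3 => [|[|[|[|[|[|k]]]]]] // _.
by rewrite -[60]/(20 * 3)%N leq_mul2l.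
Qed.

Lemma weight_le s rho u v : sat s rho -> e (rho u) (rho v) -> ty s u v != 0 ->
  (weight (rho u, rho v) + (wneg s (u, v))%:R <= (wpos s (u, v))%:R)%R.
Proof.
move=> sats uv t0; have ht := sat_T sats u v; have rl := rlow_le v sats.
case: (eqVneq (fl (rho u, rho v)) 3) => [f3|fn3].
  have t3 : ty s u v = 3.
    by move: ht t0; rewrite /hastype f3; case: (ty s u v) => [|[|[|[|[|[|[|[|[|t]]]]]]]]].
  have -> : wneg s (u, v) = 5 by rewrite /wneg t3.
  rewrite /weight f3 eqxx subrK /wpos t3 [(_, _).2]/=.
  case: (posnP (corners (rho v))) => [c0|c_gt0]; last exact: ler0n.
  have -> : (0 < rlow s v) = false by apply/negbTE; rewrite -eqn0Ngt -leqn0 -c0.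
  have deg3 := degree_ge3 (rho v); have := wpos_degree deg3.
  have := closed_degree (v := v) sats; rewrite /closed.
  case E: (cl s v) => [|x l]; last by move=> /(_ isT) ->.
  move=> _ _; apply: (natr_div_le (m := 20)); first exact: ltnW (ltnW deg3).
  by rewrite -[60]/(20 * 3)%N leq_mul2l.
have wn := wneg_sound sats fn3 t0; have gu := give_upper_sound u v sats.
have wp : wpos s (u, v) = match rlow s v with 0 | 1 => 60 | 2 => 30 | _ => 20 end + give_upper s u v.
  move: ht t0; rewrite /wpos /hastype.
  by case: (ty s u v) => [|[|[|[|[|[|[|[|[|t]]]]]]]]] //; rewrite (negPf fn3).
have c60 := wpos_corners (corners_gt0 uv fn3) rl.
rewrite wp /weight (negPf fn3) -/(taken _) [(_, _).2]/= [X in (_ <= X)%R]natrD.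
rewrite -(ler_nat rat) in gu; rewrite -(ler_nat rat) in wn.
move: wn gu c60.
move: ((wneg _ _)%:R)%R ((give_upper _ _ _)%:R)%R ((give _)%:R)%R ((_ + 30 * _)%N%:R)%R => a b g h.
by move: (60 / (corners (rho v))%:R : rat)%R (_%:R)%R => k c; clear; lra.
Qed.

(** * Blocks of darts *)

Lemma block_dart d d' : connect brel d d' -> (d' \in D) = (d \in D).
Proof.
case/connectP => p pp ->; elim: p d pp => //= x p IHp d /andP [dx /IHp ->].
by case/orP: dx => [/eqP ->|/andP [_ /eqP ->]]; rewrite ?dart_swap ?fp_dart.
Qed.

(** Reversal is an involution, and a step around a triangle is undone by two more steps. *)
Lemma brel_sym : connect_sym brel.
Proof.
have rev x y : brel x y -> connect brel y x.
  case/orP => [/eqP ->|/andP [f3 /eqP ->]]; first by apply: connect1; rewrite /brel swapK eqxx.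
  have fE : fl (fp x) == 3 by rewrite fl_fp.
  apply: (@connect_trans _ _ (fp (fp x))); apply: connect1; apply/orP; right.
    by rewrite fE eqxx.
  by rewrite fl_fp fE /= -[X in X == _](iter_fl x) (eqP f3).
apply: symmetric_from_pre => x y /connectP [p pp ->].
elim: p x pp => //= z p IHp x /andP [/rev xz /IHp zp]; exact: connect_trans zp xz.
Qed.

Definition known s (rho : nat -> T) (d : nat * nat) :=
  [/\ d.1 < K s, d.2 < K s & e (rho d.1) (rho d.2)].

Lemma block_sound s rho r n todo acc : sat s rho ->
  let P d := known s rho d /\ connect brel r (rd rho d) in
  {in todo, forall d, P d} -> {in acc, forall d, P d} -> {in block s n todo acc, forall d, P d}.
Proof.
move=> sats P; elim: n todo acc => [|n IHn] [|d todo] acc //= tP aP.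
have [[k1 k2 kd] cd] := tP d (mem_head _ _).
have tP' : {in todo, forall d, P d} by move=> x xt; apply: tP; rewrite inE xt orbT.
have rP : P (d.2, d.1).
  split; first by split=> //; rewrite e_sym.
  by apply: connect_trans cd (connect1 _); rewrite /brel eqxx.
have dP : {in d :: acc, forall d, P d}.
  by move=> x; rewrite inE => /orP [/eqP ->|/aP //]; apply: tP; rewrite mem_head.
case: ifP => _; apply: IHn => //.
have swP : {in (d.2, d.1) :: todo, forall d, P d} by move=> x; rewrite inE => /orP [/eqP ->|/tP' //].
case: ifP => // ; rewrite eqnE => /eqP t3; case Fd: F => [|w] //.
have [_ _ wK _ nxw] := tab_F sats Fd.
move=> x; rewrite inE => /orP [/eqP ->|/swP //]; split.
  by split=> //; rewrite -nxw nx_edge.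
apply: connect_trans cd (connect1 _); apply/orP; right.
have := sat_T sats d.1 d.2; rewrite t3 => /= ->.
by rewrite /rd fp_nx // nxw eqxx.
Qed.

Definition block_sum r : rat := (\sum_(d | connect brel r d) weight d)%R.

Lemma good_sound s rho a b bl : sat s rho -> known s rho (a, b) ->
  bl = block s 200 [:: (a, b)] [::] -> full_block s a b bl -> good s bl ->
  (block_sum (rho a, rho b) <= 0)%R.
Proof.
move=> sats kab blE /andP [/andP [abm ubl] /allP cbl] gd.
have blP d : d \in bl -> known s rho d /\ connect brel (rho a, rho b) (rd rho d).
  rewrite blE; apply: (block_sound (r := (rho a, rho b)) sats) => // x.
  by rewrite inE => /eqP ->; split.
have mem_bl d : connect brel (rho a, rho b) d = (d \in map (rd rho) bl).
  apply/idP/mapP => [/connectP [p pp ->]|[x /blP [_ cx] ->] //].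
  have : exists2 x, x \in bl & (rho a, rho b) = rd rho x by exists (a, b); rewrite // -memdE.
  elim: p (rho a, rho b) pp => //= d1 p IHp d0 /andP [d01 pp] [[u v] xbl xE]; apply: IHp pp _.
  have /and3P [] := cbl _ xbl; rewrite memdE eqnE => vu t0 t3.
  have [[uK vK uv] _] := blP _ xbl.
  case/orP: d01 => [/eqP ->|/andP [f3 /eqP ->]]; first by exists (v, u); rewrite ?xE.
  have ty3 : ty s u v = 3.
    have := sat_T sats u v; move: t0 f3; rewrite /hastype xE /rd /= => t0 /eqP ->.
    by case: (ty s u v) t0 => [|[|[|[|[|[|[|[|[|t]]]]]]]]].
  move: t3; rewrite ty3 /=; case Fuv: F => [|w] //; rewrite memdE => vw; exists (v, w) => //.
  by have [_ _ _ _ nxw] := tab_F sats Fuv; rewrite xE /rd fp_nx // nxw.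
have ur : uniq (map (rd rho) bl).
  rewrite map_inj_in_uniq -?uniqdE // => -[u v] [u' v'] /blP [[/= uK vK _] _] /blP [[/= uK' vK' _] _].
  by case=> /(rho_inj sats uK uK') -> /(rho_inj sats vK vK') ->.
rewrite /block_sum (eq_bigl _ _ mem_bl) -big_uniq // big_map.
have le d : d \in bl -> (weight (rd rho d) + (wneg s d)%:R <= (wpos s d)%:R)%R.
  case: d => u v dbl; have [[_ _ uv] _] := blP _ dbl; apply: weight_le => //.
  by have /and3P [_] := cbl _ dbl; rewrite eqnE.
have : (\sum_(d <- bl) weight (rd rho d) + (sumf (wneg s) bl)%:R <= (sumf (wpos s) bl)%:R)%R.
  move: (bl) le; elim=> [|d l IHl] le /=; first by rewrite big_nil addr0.
  rewrite big_cons !natrD.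
  have h1 := le d (mem_head _ _).
  have h2 := IHl (fun x xl => le x (mem_behead (s := d :: l) xl)); lra.
by move: gd; rewrite /good -(ler_nat rat); lra.
Qed.

(** * Correctness of the search *)

Definition root_maximal a b :=
  (fl (b, a) = 3 -> forall d, d \in D -> fl d = 3) /\
  forall d, connect brel (a, b) d -> fl d != 3 -> (fl d <= fl (b, a)) || (8 <= fl (b, a)).

Lemma long_cases l : 4 <= l -> l != 7 -> [\/ l = 4, l = 5, l = 6 | 8 <= l].
Proof.
by case: l => [|[|[|[|[|[|[|[|l]]]]]]]] // _ _; [constructor 1|constructor 2|constructor 3|constructor 4].
Qed.

Lemma short_kinds_sound t d d' : hastype t d' -> d \in D -> 4 <= fl d ->
  (fl d <= fl d') || (8 <= fl d') -> exists2 t', t' \in short_kinds t & hastype t' d.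
Proof.
move=> ht /fl_neq7 n7' f4 le.
have := long_cases f4 n7'.
move: ht le; rewrite /hastype; case: t => [|[|[|[|[|[|[|[|[|t]]]]]]]]] //=.
all: try (by move=> _ _ [->|->|->|f8]; [exists 4|exists 5|exists 6|exists 8]).
all: move=> /eqP -> /=; rewrite orbF => le [f|f|f|f]; move: le; rewrite ?f //.
all: try (by move=> _; exists (fl d); rewrite f).
all: by move/(leq_trans f).
Qed.

Lemma kinds_sound s rho a b x y : sat s rho -> known s rho (a, b) -> known s rho (x, y) ->
  root_maximal (rho a) (rho b) ->
  exists2 t, t \in kinds s a b (block s 200 [:: (a, b)] [::]) x y & hastype t (rho x, rho y).
Proof.
move=> sats kab kxy [mx3 mx]; have Dxy : (rho x, rho y) \in D by rewrite dartE; case: kxy.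
have f3 := fl_ge3 Dxy; rewrite /kinds; have ht := sat_T sats x y.
case: (ty s x y) ht => [|[|t]] ht; last by exists t.+2; rewrite ?inE.
  have [f3'|fn3] := eqVneq (fl (rho x, rho y)) 3.
    by exists 3; rewrite /= ?f3' //; case: ifP.
  case: ifP => [|_].
    rewrite eqnE => /eqP tba; have := sat_T sats b a; rewrite tba => /eqP /mx3.
    by move/(_ _ Dxy)/eqP; rewrite (negPf fn3).
  by exists 1; rewrite //=; move: f3 fn3; lia.
rewrite memdE; case: ifP => [xyb|_]; last first.
  have := long_cases ht (fl_neq7 Dxy).
  by rewrite /hastype => -[->|->|->|f8]; [exists 4|exists 5|exists 6|exists 8].
have f4 : 4 <= fl (rho x, rho y) by [].
apply: (short_kinds_sound (sat_T sats b a) Dxy f4); apply: mx; last by move: f4; lia.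
have [] := block_sound (r := (rho a, rho b)) (n := 200) (todo := [:: (a, b)]) (acc := [::]) sats _ _ xyb => //.
by move=> d; rewrite inE => /eqP ->; split.
Qed.

Definition extend (rho : nat -> T) k z := fun i => if i == k then z else rho i.

Lemma sat_widen s rho z : sat s rho -> (forall i, i < K s -> rho i != z) ->
  sat (widen s) (extend rho (K s) z).
Proof.
move=> [[inj tF tG] sA sS sU sT sC sK] new.
have ex i : i < K s -> extend rho (K s) z i = rho i by move=> iK; rewrite /extend ltn_eqF.
split=> //.
- split=> [i j|u v w /tF [uK vK wK uv nxw]|v w u /tG [uK vK wK uv nxw]]; last 2 first.
  + by split; rewrite ?ex //; apply: ltnW.
  + by split; rewrite ?ex //; apply: ltnW.
  have lt k : k < (K s).+1 -> k != K s -> k < K s by rewrite ltnS ltn_neqAle => -> ->.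
  rewrite /extend => /lt iK /lt jK; case: (i =P K s) iK => [-> _|_ /(_ isT) iK].
    case: (j =P K s) jK => [-> //|_ /(_ isT) jK] /esym/eqP.
    by rewrite (negPf (new _ jK)).
  case: (j =P K s) jK => [_ _ /eqP|_ /(_ isT) jK]; last exact: inj.
  by rewrite (negPf (new _ iK)).
- by move=> u v /sA [uK vK uv]; split; rewrite ?ex //; apply: ltnW.
- move=> u v; rewrite /ty /= -/(ty s u v); have := sK u v; have := sT u v.
  by case: (ty s u v) => // t htt /(_ isT) /andP [uK vK]; rewrite !ex.
- move=> v /sC [vK ul lK cyc full]; split=> //; first exact: ltnW.
  + by move=> x /lK [xK vx]; rewrite !ex //; split=> //; apply: ltnW.
  + apply: (sub_in_cycle (P := fun x => x < K s)) cyc.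
      by move=> a b aK bK; rewrite !ex.
    by apply/allP => x /lK [].
  by move=> t; rewrite ex // => /full [x xl ->]; exists x; rewrite // ex //; have [] := lK x xl.
by move=> u v /sK /andP [uK vK]; rewrite /= !ltnS (ltnW uK) (ltnW vK).
Qed.

(** The actual plane map selects a branch at every step: some successor of a true state is again
    true, possibly after naming one more vertex. Since the search succeeds, this branch ends at a
    state in which the complete block has been checked. *)
Theorem search_sound n s rho a b pend ra rb : sat s rho -> known s rho (a, b) ->
  rho a = ra -> rho b = rb -> root_maximal ra rb -> search n a b s pend ->
  (block_sum (ra, rb) <= 0)%R.
Proof.
move=> + + + + mx; elim: n s rho pend => // n IHn s rho pend sats kab aE bE.
have [aK bK ab] := kab.
have adjK x y : memn y (adj s x) -> known s rho (x, y).
  by rewrite memnE => /(sat_A sats) [].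
rewrite -[search _ _ _ _ _]/(step (search n a b) a b s pend).
have next x y : try_next (search n a b) s x y -> (block_sum (ra, rb) <= 0)%R.
  rewrite /try_next; case: ifP => // /adjK [xK yK xy]; case: ifP => // /allP old new.
  have [/hasP [w]|] := boolP (has (fun w => rho w == nx (rho x) (rho y)) (iota 0 (K s))).
    rewrite mem_iota add0n => /andP [_ wK] /eqP /esym nxw.
    have := old w; rewrite mem_iota add0n => /(_ wK).
    have [s' addE [sats' Ks']] := add_next_sound sats (And3 xK yK xy) wK nxw.
    rewrite /branch addE; apply: (IHn _ _ _ sats' _ aE bE).
    by split; rewrite ?Ks'.
  move/hasPn => fresh; set z := nx (rho x) (rho y) in fresh.
  have satw : sat (widen s) (extend rho (K s) z).
    by apply: sat_widen => // i iK; apply: fresh; rewrite mem_iota.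
  have ex i : i < K s -> extend rho (K s) z i = rho i by move=> iK; rewrite /extend ltn_eqF.
  have xyw : [/\ x < K (widen s), y < K (widen s) & e (extend rho (K s) z x) (extend rho (K s) z y)].
    by rewrite !ex //; split=> //; apply: ltnW.
  have nxw : nx (extend rho (K s) z x) (extend rho (K s) z y) = extend rho (K s) z (K s).
    by rewrite (ex x xK) (ex y yK) /extend eqxx.
  have [s' addE [sats' Ks']] := add_next_sound satw xyw (ltnSn _) nxw.
  move: new; rewrite /branch addE; apply: (IHn _ _ _ sats'); rewrite ?ex //.
  by split; rewrite ?Ks' /= ?ex //; apply: ltnW.
rewrite /step; case: pend => [d|]; first exact: next.
case: (choose _ _) => [x y|x y||]; last by []; first exact: next.
  rewrite /try_kinds; case: ifP => // /adjK kxy /allP allk.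
  have [|t tk ht] := kinds_sound sats kab kxy; first by rewrite aE bE.
  have := allk t tk; have [s' setE [sats' Ks']] := set_type_sound sats kxy ht.
  rewrite setE; apply: (IHn _ _ _ sats' _ aE bE).
  by rewrite /known Ks'.
by case: ifP => // fb gd; rewrite -aE -bE; apply: (good_sound sats kab (erefl _) fb gd).
Qed.

Lemma edge_sat a b : e a b -> sat edge_state (fun i => if i is 0 then a else b) /\
  known edge_state (fun i => if i is 0 then a else b) (0, 1).
Proof.
move=> ab; split=> //; have nab := e_neq ab.
have get0 u v : get [::] u v = 0 by rewrite /get !nth_nil.
split=> [|u v|u v|u|u v|v|u v].
- split=> [i j|u v w|v w u]; [|by rewrite /F get0|by rewrite /G get0].
  by case: i j => [|[|i]] [|[|j]] //= _ _ abE; rewrite abE eqxx in nab.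
- by case: u => [|[|u]]; rewrite /adj /= ?inE ?nth_nil // => /eqP ->; rewrite // e_sym.
- by case: u => [|[|u]]; rewrite /adj /= ?inE ?nth_nil // => /eqP ->.
- by case: u => [|[|u]] //; rewrite /adj /= nth_nil.
- by rewrite /ty get0.
- by rewrite /cl nth_nil.
by rewrite /ty get0.
Qed.

Lemma trivial_block n a b : run_trivial n -> e a b -> 4 <= fl (a, b) -> 4 <= fl (b, a) ->
  root_maximal a b -> (block_sum (a, b) <= 0)%R.
Proof.
move=> + ab fab fba mx; rewrite /run_trivial; have [sat0 k0] := edge_sat ab.
have [s1 -> [sat1 K1]] := set_type_sound (t := 1) sat0 k0 fab.
have k1 : known s1 (fun i => if i is 0 then a else b) (1, 0).
  by rewrite /known K1 /= e_sym.
have [s2 -> [sat2 K2]] := set_type_sound (t := 1) sat1 k1 fba.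
apply: (search_sound sat2) => //; by rewrite /known K2 K1.
Qed.

Lemma triangle_block n a b : run_triangle n -> e a b -> fl (a, b) = 3 -> 4 <= fl (b, a) ->
  root_maximal a b -> (block_sum (a, b) <= 0)%R.
Proof.
move=> + ab fab fba mx; rewrite /run_triangle; have [sat0 k0] := edge_sat ab.
have [|s1 -> [sat1 K1]] := set_type_sound (t := 3) sat0 k0; first exact/eqP.
have k1 : known s1 (fun i => if i is 0 then a else b) (1, 0).
  by rewrite /known K1 /= e_sym.
have [s2 -> [sat2 K2]] := set_type_sound (t := 1) sat1 k1 fba.
apply: (search_sound sat2) => //; by rewrite /known K2 K1.
Qed.

Lemma triangulation_block n a b : run_triangulation n -> e a b ->
  (forall d, d \in D -> fl d = 3) -> (block_sum (a, b) <= 0)%R.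
Proof.
move=> + ab f3; rewrite /run_triangulation; have [sat0 k0] := edge_sat ab.
have k1 : known edge_state (fun i => if i is 0 then a else b) (1, 0).
  by rewrite /known /= e_sym.
have [|s1 -> [sat1 K1]] := set_type_sound (t := 3) sat0 k1.
  by apply/eqP/f3; rewrite dartE e_sym.
apply: (search_sound sat1) => //; first by rewrite /known K1.
split=> // d /block_dart; rewrite !dartE ab => Dd; rewrite f3 //.
Qed.

Section Runs.

Variable n0 : nat.
Hypotheses (run0 : run_trivial n0) (run1 : run_triangle n0) (run2 : run_triangulation n0).

Lemma same_block r r' : connect brel r r' -> block_sum r = block_sum r'.
Proof. by move=> rr'; apply: eq_bigl => d; apply: same_connect rr' d; apply: brel_sym. Qed.

(** The block is rooted so that the reverse ba of the root has the longest non-triangular face of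
    the block. If all its faces are triangles, it is closed under the face permutation too and
    contains every dart, so the graph is a triangulation. *)
Lemma block_sum_le0 r : r \in D -> (block_sum r <= 0)%R.
Proof.
move=> Dr; have [/existsP [d1]|] := boolP [exists d, connect brel r d && (fl d != 3)]; last first.
  rewrite negb_exists => /forallP none.
  have all3 d : connect brel r d -> fl d = 3.
    by move=> rd'; have := none d; rewrite rd' /= negbK => /eqP.
  have reach d : d \in D -> connect brel r d.
    apply: (dart_ind (P := fun d => connect brel r d) Dr); first exact: connect0.
      by move=> x _ rx; apply: connect_trans rx (connect1 _); rewrite /brel eqxx.
    by move=> x _ rx; rewrite (connect_trans rx) // connect1 // /brel (all3 x rx) !eqxx orbT.
  case: r Dr all3 reach {none} => a b; rewrite dartE => ab all3 reach.
  by apply: triangulation_block run2 ab _ => d /reach /all3.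
pose P d := connect brel r d && (fl d != 3).
move=> Pd1; case: (@arg_maxnP _ d1 P fl Pd1) => -[b a] /andP [rba f3] mx.
have Dba : (b, a) \in D by rewrite (block_dart rba).
have rab : connect brel r (a, b) by apply: connect_trans rba (connect1 _); rewrite /brel eqxx.
have ab : e a b by move: Dba; rewrite dartE e_sym.
have f4 : 4 <= fl (b, a) by rewrite ltn_neqAle eq_sym f3 fl_ge3.
rewrite (same_block rab); have mxr : root_maximal a b.
  split=> [f3'|d abd fd]; first by rewrite f3' in f4.
  by apply/orP; left; apply: (mx d); rewrite /P fd (connect_trans rab abd).
have [f3'|nf3'] := eqVneq (fl (a, b)) 3; first exact: triangle_block run1 ab f3' f4 mxr.
have f4' : 4 <= fl (a, b) by rewrite ltn_neqAle eq_sym nf3' fl_ge3 ?dartE.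
exact: trivial_block run0 ab f4' f4 mxr.
Qed.

Lemma total_le0 : (\sum_(d in D) weight d <= 0)%R.
Proof.
rewrite (partition_big (fingraph.root brel) (fun r => (r \in D) && (fingraph.root brel r == r))) /=; last first.
  by move=> d Dd; rewrite root_root ?eqxx ?(block_dart (connect_root _ d)) ?Dd //; apply: brel_sym.
apply: sumr_le0 => r /andP [Dr /eqP rr].
rewrite (eq_bigl (connect brel r)); first exact: block_sum_le0.
move=> d /=; rewrite -{1}rr (root_connect brel_sym) brel_sym.
by case: (boolP (connect brel r d)) => [/block_dart ->|]; rewrite ?Dr ?andbF.
Qed.

End Runs.

(** * Special vertices on long faces *)

Lemma special_next d : d \in D -> special d -> ~~ special (fp d).
Proof.
move=> Dd /and5P [_ /eqP c1 _ _ _]; apply/negP => /and5P [_ _ _ c2 _].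
by move: c2; rewrite fp_tail // c1.
Qed.

(** Dropping a dart removes its head from the boundary walk. The next dart is kept, and the chord
    from the tail of the dropped dart to the head of the next one closes the gap. *)
Lemma bypass_path (R : pred (T * T)) m d : d \in D -> ~~ R (iter m fp d) ->
  (forall i, i < m -> R (iter i fp d) ->
     ~~ R (iter i.+1 fp d) /\ e (iter i fp d).1 (iter i.+1 fp d).2) ->
  path e d.1 (map snd [seq x <- traject fp d m.+1 | ~~ R x]).
Proof.
have edge x : x \in D -> e x.1 x.2 by rewrite inE.
have [k] := ubnP m; elim: k m d => // k IHk [|m] d mk Dd nR step.
  by rewrite /= in nR *; rewrite nR /= edge.
have Dfd : fp d \in D by rewrite fp_dart.
rewrite trajectS /=; case: (boolP (R d)) => [Rd|nRd] /=; last first.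
  rewrite edge //= -(fp_tail Dd); apply: IHk => //; first by rewrite -iterSr.
  by move=> i im; rewrite -!iterSr; apply: (step i.+1).
have [/= nRfd ch] := step 0 isT Rd.
rewrite nRfd /= ch /=; case: m mk nR step => [//|m] mk nR step.
rewrite -(fp_tail Dfd); apply: (IHk m); rewrite ?fp_dart //.
- by rewrite ltnW.
- by rewrite -2!iterSr.
by move=> i im; rewrite -!iterSr; apply: (step i.+2).
Qed.

Lemma special_count d : d \in D -> 8 <= fl d ->
  (#|[pred x | fconnect fp d x & special x]| + 8 <= fl d)%N.
Proof.
move=> Dd f8; rewrite leqNgt; apply/negP => q_big.
(* The face is traversed from just after a non-special dart, so that its last dart is kept and no
   bypass crosses the starting point. *)
have [d' dd' ns] : exists2 d', fconnect fp d d' & ~~ special d'.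
  have [sd|sd] := boolP (special d); last by exists d; rewrite ?connect0.
  by exists (fp d); rewrite ?fconnect1 ?special_next.
pose d0 := fp d'; have dd0 : fconnect fp d d0 := connect_trans dd' (fconnect1 _ _).
have D0 x : fconnect fp d x -> x \in D by move/iter_findex <-; rewrite fp_iter_dart.
have fl0 : fl d0 = fl d by rewrite (fl_same dd0).
pose orb := traject fp d0 (fl d0).
have orbE : orb = fingraph.orbit fp d0 by [].
have orbU : uniq orb by rewrite orbE orbit_uniq.
have mem_orb x : (x \in orb) = fconnect fp d x.
  rewrite orbE -fconnect_orbit; apply/esym; apply: same_connect dd0 x; exact: fconnect_sym fp_inj.
(* Bypassing exactly this many vertices leaves a cycle of length 7. *)
pose S := take (fl d - 7) [seq x <- orb | special x].
have szS : size S = fl d - 7.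
  rewrite size_take_min; apply/minn_idPl.
  have <- : #|[pred x | fconnect fp d x & special x]| = size [seq x <- orb | special x].
    rewrite -(card_uniqP (filter_uniq _ orbU)); apply: eq_card => x.
    by rewrite inE mem_filter mem_orb /= andbC.
  by move: q_big; lia.
have SP x : x \in S -> special x && (x \in orb) by move/mem_take; rewrite mem_filter.
have US : uniq S by rewrite take_uniq ?filter_uniq.
pose R := mem S.
have lastE : iter (fl d).-1 fp d0 = d'.
  by apply: fp_inj; rewrite -iterS prednK ?fl_gt0 // -fl0 iter_fl.
have pth : path e d0.1 (map snd [seq x <- traject fp d0 (fl d).-1.+1 | ~~ R x]).
  apply: bypass_path; first exact: D0.
    by rewrite lastE; apply/negP => /SP /andP []; rewrite (negPf ns).
  move=> i _ /SP /andP [sp io]; have Di : iter i fp d0 \in D by rewrite D0 -?mem_orb.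
  split; last by case/and5P: sp.
  by apply/negP => /SP /andP [] ; rewrite /= (negPf (special_next Di sp)).
rewrite prednK ?fl_gt0 // -fl0 -/orb in pth.
apply: (@cycle_C7 (map snd [seq x <- orb | ~~ R x])).
- rewrite size_map size_filter; have := count_predC R orb; rewrite size_traject fl0.
  have -> : count R orb = fl d - 7.
    rewrite -szS -size_filter; apply: perm_size; apply: uniq_perm; rewrite ?filter_uniq //.
    by move=> x; rewrite mem_filter; apply/andP/idP => [[]|xS] //; split=> //; case/andP: (SP x xS).
  by rewrite (eq_count (a2 := predC R)) //; move: f8; lia.
- rewrite map_inj_in_uniq ?filter_uniq // => x y; rewrite !mem_filter !mem_orb.
  move=> /andP [_ dx] /andP [_ dy]; apply: face_simple_head; rewrite ?D0 //.
  by rewrite (connect_trans _ dy) // (fconnect_sym fp_inj).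
rewrite (cycle_path d0.1); suff -> : last d0.1 (map snd [seq x <- orb | ~~ R x]) = d0.1 by [].
have -> : orb = rcons (traject fp d0 (fl d).-1) d'.
  by rewrite /orb fl0 -{1}(prednK (fl_gt0 d)) trajectSr lastE.
have nRd' : ~~ R d' by apply/negP => /SP /andP []; rewrite (negPf ns).
by rewrite filter_rcons nRd' map_rcons last_rcons fp_tail // D0.
Qed.

(** * Summation of the charges *)

Definition cost d : nat := if fl d == 3 then 5 else base (fl d) + 30 * special d.
Definition share d : rat :=
  (if fl d == 3 then (if corners d.2 == 0%N then 60 / #|nbrs d.2|%:R else 0)
   else 60 / (corners d.2)%:R)%R.

Lemma weightE d : weight d = (share d - (cost d)%:R + ((give d)%:R - (taken d)%:R))%R.
Proof.
rewrite /weight /share /cost /give /taken; case: eqVneq => [->|_] /=.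
  by rewrite subrr addr0.
by rewrite !natrD; lra.
Qed.

Lemma sum_share : (\sum_(d in D) share d = 60 * #|T|%:R)%R.
Proof.
(* After reversal the darts are grouped by the vertex whose share they carry; each vertex hands out
   60 in all. *)
rewrite (reindex_inj (inv_inj swapK)) /= (eq_bigl (fun d => e d.1 d.2)); last first.
  by move=> d; rewrite dart_swap inE.
rewrite -(pair_big_dep xpredT e (fun v u => share (u, v))) /=.
rewrite (eq_bigr (fun _ => 60 : rat)%R) => [|v _]; first by rewrite sumr_const mulr_natr cardE.
have degv : #|nbrs v| != 0 by rewrite -lt0n (leq_trans _ (degree_ge3 v)).
have sumE (P : pred T) (x : rat) : (\sum_(u | e v u && P u) x = x *+ #|[set u in nbrs v | P u]|)%R.
  by rewrite -sumr_const; apply: eq_bigl => u; rewrite !inE.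
have [c0|c0] := eqVneq (corners v) 0.
  rewrite (eq_bigr (fun _ => 60 / #|nbrs v|%:R : rat)%R) => [|u vu]; last first.
    rewrite /share /= c0 eqxx; case: eqVneq => // fn3.
    by have := corners_gt0 (u := u) (v := v); rewrite e_sym c0 => /(_ vu fn3).
  have sum_nbrs (x : rat) : (\sum_(u | e v u) x = x *+ #|nbrs v|)%R.
    by rewrite -sumr_const; apply: eq_bigl => u; rewrite !inE.
  by rewrite sum_nbrs -[LHS]mulr_natr divfK // pnatr_eq0.
rewrite (bigID (fun u => fl (u, v) == 3)) /= big1 => [|u /andP [_ f3]]; last first.
  by rewrite /share f3 /= (negPf c0).
rewrite add0r (eq_bigr (fun _ => 60 / (corners v)%:R : rat)%R) => [|u /andP [_ f3]]; last first.
  by rewrite /share (negPf f3).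
by rewrite sumE -/(corners v) -[LHS]mulr_natr divfK // pnatr_eq0.
Qed.

(** Passing to the opposite dart permutes the darts of 4-faces, so the transfers cancel. *)
Lemma sum_give : \sum_(d in D) give d = \sum_(d in D) taken d.
Proof.
rewrite (reindex_inj (inj_comp fp_inj fp_inj)) /=; apply: eq_big => d; first by rewrite !fp_dart.
by move=> _; rewrite /taken; case: ifP => // f4; rewrite /give fl_fp2 f4.
Qed.

(** There is equality for lengths 3 to 6. For a length l >= 8 with s special darts it reads 240 + 55
    l + 30 s <= 85 l, that is s + 8 <= l, which is [special_count]. *)
Lemma face_cost r : r \in D -> 240 + \sum_(d | fconnect fp r d) cost d <= 85 * fl r.
Proof.
move=> Dr; have f3 := fl_ge3 Dr.
have sum_const c : \sum_(d | fconnect fp r d) c = fl r * c.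
  by rewrite sum_nat_const; congr (_ * _).
have [f8|f8] := leqP 8 (fl r).
  have -> : \sum_(d | fconnect fp r d) cost d =
      \sum_(d | fconnect fp r d) 55 + 30 * \sum_(d | fconnect fp r d) special d.
    rewrite big_distrr -big_split; apply: eq_bigr => d rd.
    have fd : 8 <= fl d by rewrite -(fl_same rd).
    rewrite /cost; case: (fl d) fd => [|[|[|[|[|[|[|k]]]]]]] //.
  rewrite sum_const -[in X in 30 * X]big_mkcondr sum1_card.
  have := special_count Dr f8; move: (fl r) #|_| => a b; lia.
have sp d : fconnect fp r d -> special d = false.
  by move=> rd; apply/negbTE; rewrite negb_and -ltnNge -(fl_same rd) f8.
rewrite (eq_bigr (fun _ => if fl r == 3 then 5 else base (fl r))) => [|d rd]; last first.
  by rewrite /cost -(fl_same rd) sp // muln0 addn0.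
rewrite sum_const; have := fl_neq7 Dr; move: f3 f8.
by case: (fl r) => [|[|[|[|[|[|[|[|k]]]]]]]].
Qed.

Lemma sum_cost : 240 * nfaces e rt + \sum_(d in D) cost d <= 85 * #|D|.
Proof.
pose Q r := (r \in D) && (froot fp r == r).
have sc := fconnect_sym fp_inj.
have part (f : T * T -> nat) : \sum_(d in D) f d = \sum_(r | Q r) \sum_(d | fconnect fp r d) f d.
  rewrite (partition_big (froot fp) Q) => [|d Dd]; last first.
    rewrite /Q root_root // eqxx andbT; have /iter_findex <- := connect_root (frel fp) d.
    by rewrite fp_iter_dart.
  apply: eq_bigr => r /andP [Dr /eqP rr]; apply: eq_bigl => d.
  rewrite -{1}rr (root_connect sc) sc andbC.
  by case: (boolP (fconnect fp r d)) => // /iter_findex <-; rewrite fp_iter_dart Dr.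
have nfE : nfaces e rt = \sum_(r | Q r) 1.
  by rewrite sum1_card; apply: eq_card => r; rewrite inE [RHS]inE /= andbC.
rewrite nfE -sum1_card !part !big_distrr -big_split; apply: leq_sum => r /andP [Dr _] /=.
by rewrite sum1_card muln1 face_cost.
Qed.

Theorem edge_bound n0 : run_trivial n0 -> run_triangle n0 -> run_triangulation n0 ->
  7 * nedges e + 48 <= 18 * #|T|.
Proof.
move=> h0 h1 h2; have := total_le0 h0 h1 h2.
under eq_bigr do rewrite weightE.
rewrite !big_split /= !sumrN -!natr_sum sum_share sum_give subrr addr0 subr_le0 -natrM ler_nat.
(* With n vertices, m edges and f faces, 60 n <= 170 m - 240 f; substituting f = m + 2 - n gives 70
   m + 480 <= 180 n. *)
have := sum_cost; have := euler; rewrite card_darts.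
by move: (\sum_(d in D) cost d) (nfaces e rt) (nedges e) #|T| => c f m n; lia.
Qed.

End Plane.

(** * The three computations and the theorem *)

Lemma trivial_run : run_trivial 100.
(* The number 100 only bounds the depth of the search tree; the virtual machine evaluates the whole
   tree when the kernel checks the cast. *)
Proof. vm_cast_no_check (erefl true). Qed.

Lemma triangle_run : run_triangle 100.
Proof. vm_cast_no_check (erefl true). Qed.

Lemma triangulation_run : run_triangulation 100.
Proof. vm_cast_no_check (erefl true). Qed.

Theorem theorem1p2 (T : finType) (e : rel T)
  (e_sym : symmetric e) (e_irr : irreflexive e) :
  (7 <= #|T|)%N ->
  two_connected e ->
  plane_graph e ->
  ~ has_C7 e ->
  (forall S : {set T}, (0 < #|S| <= 4)%N -> ~~ sparse e (18%:R / 7%:R) S) ->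
  ((nedges e)%:R <= (18%:R / 7%:R) * (#|T|)%:R - 48%:R / 7%:R :> rat)%R.
Proof.
move=> n7 conn2 [rt [rtP euler]] noC7 nosparse.
have dense (S : {set T}) : 0 < #|S| <= 4 ->
    nth 0 [:: 0; 3; 6; 8; 11] #|S| <= #|edges_touching e S|.
  (* After clearing the denominator, integrality rounds 18k/7 up to 3, 6, 8, 11. *)
  move=> S4; have := nosparse S S4; rewrite /sparse -ltNge mulrAC ltr_pdivrMr // -!natrM ltr_nat.
  by move: #|edges_touching e S| => t; case: #|S| S4 => [|[|[|[|[|k]]]]] //= _; lia.
have bound : 7 * nedges e + 48 <= 18 * #|T|.
  exact: (edge_bound e_sym e_irr rtP euler conn2 n7 noC7 dense
    trivial_run triangle_run triangulation_run).
move: bound; rewrite -(ler_nat rat) natrD !natrM; lra.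
Qed.
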